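(* Let $\Gamma$ be a countable group, let $(X,T)$ be a $\Gamma$-dynamical system, and let $d$ be a positive integer such that $\dim(X,T)<\frac{d}{2}$. Then there is a dense $G_\delta$ set $G\subseteq C(X,[0,1]^d)$ such that for every $f\in G$ the function $f^\Gamma:X\to([0,1]^d)^\Gamma$ is an almost embedding of $(X,T)$ into $(([0,1]^d)^\Gamma,\mathrm{shift})$.
   Context: A $\Gamma$-dynamical system $(X,T)$ is a compact metric space $X$ with a homomorphism $T$, $\gamma\mapsto T_\gamma$, from the countable discrete group $\Gamma$ to the group of self-homeomorphisms of $X$. $\mathrm{Prob}(X,T)$ is the set of $T$-invariant Borel probability measures on $X$. $C(X,[0,1]^d)$ is the space of continuous functions $X\to[0,1]^d$ with the uniform metric. The shift action on $([0,1]^d)^\Gamma$ (product topology) is $(\mathrm{shift}_\gamma(x))_{\gamma'}=x_{\gamma^{-1}\gamma'}$, and for $f\in C(X,[0,1]^d)$ the continuous equivariant map $f^\Gamma:X\to([0,1]^d)^\Gamma$ is $f^\Gamma(x)_\gamma=f(T_{\gamma^{-1}}(x))$. $\mathrm{Cov}(X)$ is the set of finite open covers of $X$; $\mathcal{V}\succeq\mathcal{U}$ means every $V\in\mathcal{V}$ is contained in some $U\in\mathcal{U}$; $\mathrm{ord}(\mathcal{V},x)=-1+\sum_{V\in\mathcal{V}}\mathbf{1}_V(x)$; and $$\dim(X,T)=\sup_{\mathcal{U}\in\mathrm{Cov}(X)}\ \inf_{\mathcal{V}\in\mathrm{Cov}(X),\,\mathcal{V}\succeq\mathcal{U}}\ \sup_{\mu\in\mathrm{Prob}(X,T)}\int_X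 \mathrm{ord}(\mathcal{V},x)\,d\mu(x),$$ with $\dim(X,T)=-\infty$ if $\mathrm{Prob}(X,T)=\emptyset$. An almost embedding of a $\Gamma$-dynamical system $(X,T)$ into a $\Gamma$-dynamical system $(Y,S)$ is a continuous $\Gamma$-equivariant map $g:X\to Y$ such that for every $\mu\in\mathrm{Prob}(X,T)$ the map $g$ induces a measure-theoretic isomorphism (modulo null sets) between $(X,T,\mu)$ and $(Y,S,g_*\mu)$. *)

(* Defs.v *)
From HB Require Import structures.
From mathcomp Require Import all_boot all_order all_algebra.
From mathcomp Require Import all_classical all_reals all_analysis.

Set Implicit Arguments.
Unset Strict Implicit.
Unset Printing Implicit Defensive.

Import Order.TTheory GRing.Theory Num.Theory.
Import numFieldNormedType.Exports.

Local Open Scope classical_set_scope.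
Local Open Scope ring_scope.

Definition homeomorphism (X Y : topologicalType) (f : X -> Y) : Prop :=
  continuous f /\
  exists g : Y -> X, [/\ continuous g, cancel f g & cancel g f].

(* A metric, when there is one, is carried by the type of the space; the notions
   below only depend on the topology. *)
Record dynamical_system (Gamma : groupType) (X : topologicalType)
    (T : Gamma -> X -> X) : Prop := {
  ds_compact : compact [set: X] ;
  ds_homeo : forall g, homeomorphism (T g) ;
  ds_mul : forall g h x, T (g * h)%g x = T g (T h x) }.

(* Measurable types of the library are pointed.  To also cover the empty space
   (which has no probability measure), the base point is part of the data of a
   Borel probability measure; the sigma-algebra does not depend on it. *)
Definition pointed_at (X : topologicalType) (x0 : X) : Type := X.

HB.instance Definition _ (X : topologicalType) (x0 : X) :=
  Choice.copy (pointed_at x0) X.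
HB.instance Definition _ (X : topologicalType) (x0 : X) :=
  isPointed.Build (pointed_at x0) x0.

Definition borel (X : topologicalType) (x0 : X) :=
  g_sigma_algebraType (@open X : set (set (pointed_at x0))).

Record borel_prob (R : realType) (X : topologicalType) := BorelProb {
  bp_point : X ;
  bp_measure :> probability (borel bp_point) R }.

Definition invariant_prob (R : realType) (Gamma : groupType)
    (X : topologicalType) (T : Gamma -> X -> X) : set (borel_prob R X) :=
  [set mu | forall (g : Gamma) (A : set (borel (bp_point mu))),
     measurable A -> mu (T g @^-1` A) = mu A].

Definition Cov (X : topologicalType) : set (set (set X)) :=
  [set V | [/\ finite_set V, forall A, V A -> open A
             & \bigcup_(A in V) A = setT]].

Definition refines (X : Type) (V U : set (set X)) : Prop :=
  forall A, V A -> exists2 B, U B & A `<=` B.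

Definition cov_ord (R : realType) (X : Type) (V : set (set X)) (x : X) : R :=
  -1 + \sum_(A \in V) (\1_A : X -> R) x.

(* [ereal_sup set0 = -oo], so this is [-oo] when there is no invariant
   probability measure. *)
Definition ds_dim (R : realType) (Gamma : groupType)
    (X : topologicalType) (T : Gamma -> X -> X) : \bar R :=
  ereal_sup [set ereal_inf [set ereal_sup
      [set (\int[bp_measure mu]_x (cov_ord R V x)%:E)%E
        | mu in invariant_prob (R := R) T]
    | V in [set V | Cov V /\ refines V U]]
  | U in @Cov X].

Lemma ds_dim_no_invariant_prob (R : realType) (Gamma : groupType)
    (X : topologicalType) (T : Gamma -> X -> X) :
  invariant_prob (R := R) T = set0 -> ds_dim R T = -oo%E.
Proof.
move=> P0; rewrite /ds_dim P0.
apply/eqP; rewrite -leeNy_eq; apply: ge_ereal_sup => _ [U CU <-].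
apply: ereal_inf_lbound; exists U => /=; last by rewrite image_set0 ereal_sup0.
by split=> // A UA; exists A.
Qed.

(* [phi] restricts to an isomorphism mod null sets from (X, T, mu) to
   (Y, S, nu): it is an equivariant, bimeasurable and measure-preserving
   bijection between invariant Borel sets of full measure. *)
Record isomorphism_mod0 (R : realType) (Gamma : groupType)
    (X Y : topologicalType) (x0 : X) (y0 : Y)
    (T : Gamma -> X -> X) (S : Gamma -> Y -> Y)
    (mu : set (borel x0) -> \bar R) (nu : set (borel y0) -> \bar R)
    (phi : borel x0 -> borel y0) (psi : borel y0 -> borel x0)
    (X0 : set (borel x0)) (Y0 : set (borel y0)) : Prop := {
  iso_dom_measurable : measurable X0 ;
  iso_cod_measurable : measurable Y0 ;
  iso_dom_full : mu X0 = 1%E ;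
  iso_cod_full : nu Y0 = 1%E ;
  iso_dom_invariant : forall g x, X0 x -> X0 (T g x) ;
  iso_cod_invariant : forall g y, Y0 y -> Y0 (S g y) ;
  iso_fun : forall x, X0 x -> Y0 (phi x) ;
  iso_inv : forall y, Y0 y -> X0 (psi y) ;
  iso_funK : forall x, X0 x -> psi (phi x) = x ;
  iso_invK : forall y, Y0 y -> phi (psi y) = y ;
  iso_fun_measurable : measurable_fun X0 phi ;
  iso_inv_measurable : measurable_fun Y0 psi ;
  iso_preserving : forall B, measurable B -> B `<=` Y0 ->
    mu (X0 `&` phi @^-1` B) = nu B ;
  iso_equivariant : forall g x, X0 x -> phi (T g x) = S g (phi x) }.

Definition induces_isomorphism (R : realType) (Gamma : groupType)
    (X Y : topologicalType) (T : Gamma -> X -> X) (S : Gamma -> Y -> Y)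
    (phi : X -> Y) (mu : borel_prob R X) : Prop :=
  let x0 := bp_point mu in
  let phi' : borel x0 -> borel (phi x0) := phi in
  exists psi X0 Y0,
    isomorphism_mod0 T S mu (pushforward mu phi') phi' psi X0 Y0.

Definition almost_embedding (R : realType) (Gamma : groupType)
    (X Y : topologicalType) (T : Gamma -> X -> X) (S : Gamma -> Y -> Y)
    (phi : X -> Y) : Prop :=
  [/\ continuous phi,
      forall g x, phi (T g x) = S g (phi x)
    & forall mu, invariant_prob (R := R) T mu ->
        induces_isomorphism T S phi mu].

Definition cube (R : realType) (d : nat) : set 'rV[R]_d :=
  [set v | forall i, 0 <= v ord0 i <= 1].
Arguments cube : clear implicits.

(* C(X, Y), with the topology of uniform convergence. *)
Definition C_unif (X : topologicalType) (Y : uniformType) : Type :=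
  continuousType X Y.

HB.instance Definition _ (X : topologicalType) (Y : uniformType) :=
  Choice.copy (C_unif X Y) (continuousType X Y).
HB.instance Definition _ (X : topologicalType) (Y : uniformType) :=
  Uniform.copy (C_unif X Y)
    (initial_topology
       ((fun f => f : X -> Y) : continuousType X Y -> {uniform X -> Y})).

Definition shift_space (R : realType) (Gamma : groupType) (d : nat) :=
  {ptws Gamma -> cube R d}.

Definition shift_action (R : realType) (Gamma : groupType) (d : nat) (g : Gamma)
    (x : shift_space R Gamma d) : shift_space R Gamma d :=
  fun h => x (g^-1 * h)%g.

Lemma compact_cube (R : realType) (d : nat) : compact [set: cube R d].
Proof.
have cc : compact (cube R d).
  rewrite (_ : cube R d = [set v | forall i, `[0, 1]%classic (v ord0 i)]).
    exact: (@rV_compact R d (fun=> `[0, 1]%classic)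
      (fun=> @segment_compact R 0 1)).
  by apply/seteqP; split=> v /= + i => /(_ i); rewrite in_itv.
move=> F PF _.
have FC : F (set_val @^-1` cube R d).
  by apply: (@filterS _ F _ setT) => [x _|]; [exact: set_valP|exact: filterT].
have [v [Cv clv]] := cc (set_val @ F) (fmap_proper_filter _ PF) FC.
exists (exist _ v (mem_set Cv)); split=> // A B FA /=.
move=> [_ [[W oW <-] Wv WB]].
have [_ [[a Aa <-] Wa]] : (set_val @` A) `&` W !=set0.
  apply: clv; last exact: open_nbhs_nbhs.
  by apply: (@filterS _ F _ A) => // a Aa; exists a.
by exists a; split=> //; exact: WB.
Qed.

Lemma shift_action_mul (R : realType) (Gamma : groupType) (d : nat)
    (g h : Gamma) (x : shift_space R Gamma d) :
  shift_action (g * h)%g x = shift_action g (shift_action h x).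
Proof. by apply/funext => k; rewrite /shift_action invgM mulgA. Qed.

Lemma shift_action_continuous (R : realType) (Gamma : groupType) (d : nat)
    (g : Gamma) : continuous (@shift_action R Gamma d g).
Proof.
move=> x; have FF : Filter (@shift_action R Gamma d g @ nbhs x) by exact: fmap_filter.
apply/cvg_sup => h.
apply: (@continuous_comp_initial _ _ _ (proj h) (@shift_action R Gamma d g)).
exact: (@proj_continuous _ _ (g^-1 * h)%g).
Qed.

Lemma shift_action_ds (R : realType) (Gamma : groupType) (d : nat) :
  dynamical_system (@shift_action R Gamma d).
Proof.
split; last exact: shift_action_mul.
- rewrite (_ : [set: _] =
    [set f : shift_space R Gamma d | forall i, [set: cube R d] (f i)]).
    exact: (@tychonoff Gamma (fun=> cube R d) (fun=> setT) (fun=> @compact_cube R d)).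
  by apply/seteqP.
- move=> g; split; first exact: shift_action_continuous.
  exists (@shift_action R Gamma d g^-1%g); split.
  + exact: shift_action_continuous.
  + by move=> x; rewrite -shift_action_mul mulVg; apply/funext => h;
      rewrite /shift_action invg1 mul1g.
  + by move=> x; rewrite -shift_action_mul mulgV; apply/funext => h;
      rewrite /shift_action invg1 mul1g.
Qed.

Definition orbit_map (R : realType) (Gamma : groupType) (d : nat)
    (X : topologicalType) (T : Gamma -> X -> X) (f : C_unif X (cube R d))
    (x : X) : shift_space R Gamma d :=
  fun g => (f : continuousType X (cube R d)) (T g^-1%g x).

(* Main.v *)
Require Import Defs.
From HB Require Import structures.
From mathcomp Require Import all_boot all_order all_algebra.
From mathcomp Require finmap.
From mathcomp Require Import all_classical all_reals all_analysis.
From mathcomp Require Import measurable_realfun borel_hierarchy.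
From mathcomp Require Import ring lra.

(** Let phi = f^Gamma be the orbit map of f, let mu be an invariant probability
    measure, and let lambda be the relatively independent self-joining of mu over
    phi: lambda(A x B) is the integral of P(A | phi) P(B | phi). It is invariant and
    carried by the pairs with the same image under phi, and phi is injective modulo
    mu exactly when lambda is carried by the diagonal.

    The restriction of lambda to the complement of the diagonal is again invariant
    and symmetric, so both its marginals are one invariant measure rho <= mu.
    Suppose rho is not 0. The dimension hypothesis provides covers V of arbitrarily
    small mesh such that the integral of ord(V, .) against every invariant
    probability measure, in particular against the normalization of rho, is at most
    a fixed beta < d / 2. Since ord takes integer values, the off-diagonal pairs with
    ord(V, x) + ord(V, x') < d have a mass bounded from below independently of V.
    Now assume that f tells apart, up to a small distance, the points x and x' with
    ord(V, x) + ord(V, x') < d. As lambda is carried by pairs with f x = f x',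
    the complement of the diagonal then gives a definite mass to every neighbourhood
    of the diagonal, which is absurd. This is offdiag_marginalT_eq0; it rests on the
    invariance of rho (offdiag_marginal_invariant) and on a Markov inequality for
    finite partitions approximating the diagonal (offdiag_multiplicity).

    With rho = 0, every Borel set of X is modulo mu the preimage of a Borel set under
    phi (relprod_compl_eq0). Applied to countably many sets separating points, this
    makes phi injective off a null set (injective_off_null), and restricting to
    sigma-compact sets gives a Borel inverse on an invariant set of full measure
    (injective_induces_isomorphism).

    It remains to see that the functions f with the separation property for every
    scale form a dense G_delta. At a given scale they form an open set, by
    compactness and lower semicontinuity of ord (open_separating). They are dense
    (uniformly_dense_separating): f is approximated by the composition of a partition
    of unity subordinate to V with the affine map sending the vertices of the nerve to
    points of the cube in general position (general_position). At most d + 1 vertices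
    are involved when ord(V, x) + ord(V, x') < d, and these are affinely
    independent, so x and x' with the same value have the same barycentric
    coordinates and lie in a common member of V. The Baire category theorem
    (C_unif_Baire) concludes. *)

Set Implicit Arguments.
Unset Strict Implicit.
Unset Printing Implicit Defensive.

Import Order.TTheory GRing.Theory Num.Theory.
Import numFieldNormedType.Exports.

Local Open Scope classical_set_scope.
Local Open Scope ring_scope.

(** * Conditional probabilities and the relatively independent self-joining *)

Section conditional_probability.
Local Open Scope ereal_scope.
Context d1 d2 (X : measurableType d1) (Y : measurableType d2) (R : realType).
Variables (mu : {finite_measure set X -> \bar R}) (phi : X -> Y).
Hypothesis mphi : measurable_fun setT phi.

(** Conditional probability of A given phi, as a function on Y rather than as a
    phi-measurable function on X: its behaviour under equivariant maps is then
    a composition on Y. *)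
Definition cond_prob (A : set X) (h : Y -> \bar R) :=
  [/\ forall y, 0 <= h y, measurable_fun setT h
    & forall C, measurable C ->
        \int[mu]_(x in phi @^-1` C) h (phi x) = mu (A `&` phi @^-1` C)].

Let mpre C : measurable C -> measurable (phi @^-1` C).
Proof. by move=> mC; rewrite -[X in measurable X]setTI; exact: mphi. Qed.

Lemma finite_image_measure (m : {finite_measure set X -> \bar R}) :
  exists nu : {finite_measure set Y -> \bar R},
    (nu : set Y -> \bar R) = pushforward m phi.
Proof.
pose nu0 : {measure set Y -> \bar R} := pushforward m phi.
have fin0 : fin_num_fun (nu0 mphi).
  by move=> C mC; apply: fin_num_measure; exact: mpre.
pose nu1 := @Measure_isFinite.Build _ _ _ (nu0 mphi) fin0.
pose nu : {finite_measure set Y -> \bar R} :=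
  HB.pack (pushforward m phi : set Y -> \bar R) (Measure.class (nu0 mphi)) nu1.
by exists nu.
Qed.

Lemma integral_image_measure (m : {finite_measure set X -> \bar R})
    (nu : {finite_measure set Y -> \bar R}) :
    (nu : set Y -> \bar R) = pushforward m phi ->
  forall C, measurable C -> forall g : Y -> \bar R, (forall y, 0 <= g y) ->
    measurable_fun setT g ->
  \int[nu]_(y in C) g y = \int[m]_(x in phi @^-1` C) g (phi x).
Proof.
move=> nuE C mC g g0 mg; rewrite nuE.
rewrite (@ge0_integral_pushforward _ _ _ _ _ phi mphi m C g)//.
exact: measurable_funTS.
Qed.

Lemma integral_mrestr A (mA : measurable A) (f : X -> \bar R) :
  measurable_fun setT f -> (forall x, 0 <= f x) ->
  \int[mrestr mu mA]_x f x = \int[mu]_(x in A) f x.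
Proof.
move=> mf f0.
have mCA := measurableC mA.
rewrite -(setUv A) ge0_integral_setU//=; last first.
- by rewrite disj_set2E setICr.
- by rewrite setUv.
rewrite [X in _ + X](_ : _ = 0) ?adde0.
  apply: eq_measure_integral => B mB BA.
  by rewrite /= /mrestr setIidl.
transitivity (\int[mzero]_(x in ~` A) f x); last exact: integral_measure_zero.
apply: eq_measure_integral => B mB BA.
rewrite /= /mrestr (_ : B `&` A = set0) ?measure0//.
by apply/seteqP; split => // x [/BA].
Qed.

(** The Radon-Nikodym derivative, with respect to the image of mu, of the image
    of the restriction of mu to A. *)
Lemma cond_prob_exists_density A : measurable A ->
  exists2 h, cond_prob A h & forall f : Y -> \bar R, (forall y, 0 <= f y) ->
    measurable_fun setT f ->
    \int[mu]_(x in A) f (phi x) = \int[mu]_x (f (phi x) * h (phi x)).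
Proof.
move=> mA.
have [nuA nuAE] := finite_image_measure (mrestr mu mA).
have [nu nuE] := finite_image_measure mu.
have dom : nuA `<< nu.
  apply/null_content_dominatesP => C mC.
  change (nu C = 0 -> nuA C = 0).
  rewrite nuE nuAE /pushforward => nuC0; apply/eqP; rewrite -measure_le0.
  rewrite -[leRHS]nuC0; apply: le_measure; rewrite ?inE; [|exact: mpre|].
    by apply: measurableI => //; exact: mpre.
  exact: subIsetl.
pose h := Radon_Nikodym_SigmaFinite.f nuA nu.
have h0 : forall y, 0 <= h y by exact: Radon_Nikodym_SigmaFinite.f_ge0.
have mh : measurable_fun setT h.
  exact: measurable_int (Radon_Nikodym_SigmaFinite.f_integrable dom).
exists h.
  split=> // C mC; rewrite setIC.
  transitivity (nuA C); last by rewrite nuAE.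
  rewrite -(integral_image_measure nuE)//.
  exact/esym/(Radon_Nikodym_SigmaFinite.f_integral dom).
move=> f f0 mf.
rewrite -(integral_mrestr mA); last 2 first.
- exact: measurableT_comp.
- by move=> x; exact: f0.
have := integral_image_measure nuAE measurableT f0 mf.
rewrite preimage_setT => <-.
have := @integral_image_measure mu nu nuE setT measurableT (f \* h).
rewrite preimage_setT => <-; last 2 first.
- by move=> y; rewrite mule_ge0.
- exact: emeasurable_funM.
exact/esym/(@Radon_Nikodym_SigmaFinite.change_of_variables _ _ _ nuA nu dom f).
Qed.

(** Any two versions of the conditional probability agree almost everywhere, so
    the change of variables holds for each of them. *)
Lemma cond_prob_density A h : measurable A -> cond_prob A h ->
  forall f : Y -> \bar R, (forall y, 0 <= f y) -> measurable_fun setT f ->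
    \int[mu]_(x in A) f (phi x) = \int[mu]_x (f (phi x) * h (phi x)).
Proof.
move=> mA [h0 mh hE] f f0 mf.
have [k [k0 mk kE] ->//] := cond_prob_exists_density mA.
have [nu nuE] := finite_image_measure mu.
have toY := integral_image_measure nuE.
have kh : ae_eq nu setT k h.
  apply: integral_ae_eq => //.
  - apply/integrableP; split=> //.
    rewrite (eq_integral k) => [|y _]; last by rewrite gee0_abs.
    rewrite toY// kE// preimage_setT setIT -ge0_fin_numE ?measure_ge0//.
    exact: fin_num_measure.
  - by move=> E _ mE; rewrite !toY// kE// hE.
have := @ae_eq_integral _ _ _ nu setT (f \* h) (f \* k) measurableT.
rewrite !toY//.
- rewrite preimage_setT; apply.
  + exact: emeasurable_funM.
  + exact: emeasurable_funM.
  + exact: ae_eqe_mul2l.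
- by move=> y; rewrite mule_ge0.
- exact: emeasurable_funM.
- by move=> y; rewrite mule_ge0.
- exact: emeasurable_funM.
Qed.

(** Both sides integrate the product of the two conditional probabilities. Every
    property of the joining in its second argument, and its independence of
    the chosen versions, comes from this symmetry. *)
Lemma cond_prob_swap A B hA hB : measurable A -> measurable B ->
  cond_prob A hA -> cond_prob B hB ->
  \int[mu]_(x in A) hB (phi x) = \int[mu]_(x in B) hA (phi x).
Proof.
move=> mA mB cA cB; have [hA0 mhA _] := cA; have [hB0 mhB _] := cB.
rewrite (cond_prob_density mA cA)// (cond_prob_density mB cB)//.
by apply: eq_integral => x _; rewrite muleC.
Qed.

Definition cprob A : Y -> \bar R := xget (cst 0) [set h | cond_prob A h].

Lemma cprobP A : measurable A -> cond_prob A (cprob A).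
Proof.
by move=> mA; rewrite /cprob; case: xgetP => // /(_ _ _)/= nex;
  have [h /nex] := cond_prob_exists_density mA.
Qed.

(** The mass of A x B under the relatively independent self-joining of mu over
    phi. Rectangles are enough below, so the joining is not extended to a
    measure on X x X. *)
Definition relprod A B : R := fine (\int[mu]_(x in A) cprob B (phi x)).

Let mphic (h : Y -> \bar R) A : measurable_fun setT h ->
  measurable_fun A (h \o phi).
Proof. by move=> mh; apply: measurable_funTS; exact: measurableT_comp. Qed.

Lemma integral_cprob_le A B : measurable A -> measurable B ->
  \int[mu]_(x in A) cprob B (phi x) <= mu B.
Proof.
move=> mA mB; have [h0 mh hE] := cprobP mB.
apply: (@le_trans _ _ (\int[mu]_x cprob B (phi x))).
  by apply: ge0_subset_integral => //; exact: mphic.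
by have := hE _ measurableT; rewrite preimage_setT setIT => ->.
Qed.

Lemma integral_cprob_fin A B : measurable A -> measurable B ->
  \int[mu]_(x in A) cprob B (phi x) \is a fin_num.
Proof.
move=> mA mB; have [h0 mh hE] := cprobP mB.
rewrite ge0_fin_numE; last by apply: integral_ge0 => x _; exact: h0.
apply: le_lt_trans (integral_cprob_le mA mB) _.
by rewrite -ge0_fin_numE ?measure_ge0// fin_num_measure.
Qed.

Lemma relprod_ge0 A B : measurable B -> (0 <= relprod A B)%R.
Proof.
by move=> mB; have [h0 _ _] := cprobP mB; apply/fine_ge0/integral_ge0.
Qed.

Lemma relprod_cond_prob A B h : measurable A -> measurable B ->
  cond_prob B h -> relprod A B = fine (\int[mu]_(x in A) h (phi x)).
Proof.
move=> mA mB hB; rewrite /relprod (cond_prob_swap mA mB (cprobP mA) (cprobP mB)).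
by rewrite (cond_prob_swap mA mB (cprobP mA) hB).
Qed.

Lemma relprodC A B : measurable A -> measurable B -> relprod A B = relprod B A.
Proof.
by move=> mA mB; rewrite /relprod (cond_prob_swap mA mB (cprobP mA) (cprobP mB)).
Qed.

Lemma relprodTl B : measurable B -> relprod setT B = fine (mu B).
Proof.
move=> mB; have [_ _ /(_ _ measurableT)] := cprobP mB.
by rewrite /relprod preimage_setT setIT => ->.
Qed.

Lemma relprod0l B : relprod set0 B = 0%R.
Proof. by rewrite /relprod integral_set0. Qed.

Lemma relprodUl A A' B : measurable A -> measurable A' -> measurable B ->
  A `&` A' = set0 ->
  (relprod (A `|` A') B = relprod A B + relprod A' B)%R.
Proof.
move=> mA mA' mB AA'; have [h0 mh hE] := cprobP mB.
rewrite /relprod -fineD ?integral_cprob_fin//; congr fine.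
apply: ge0_integral_setU => //; first exact: mphic.
by rewrite disj_set2E AA'.
Qed.

(** The conditional probability of B integrates to 0 over the preimage of C. This
    is the sense in which the joining is carried by the pairs with the same image
    under phi. *)
Lemma relprod_separated A B C : measurable A -> measurable B -> measurable C ->
  A `<=` phi @^-1` C -> B `&` phi @^-1` C = set0 -> relprod A B = 0%R.
Proof.
move=> mA mB mC AC BC; have [h0 mh hE] := cprobP mB.
rewrite /relprod; suff -> : \int[mu]_(x in A) cprob B (phi x) = 0 by [].
apply/eqP; rewrite eq_le integral_ge0 ?andbT//.
rewrite [leRHS](_ : _ = mu (B `&` phi @^-1` C)); last by rewrite BC measure0.
rewrite -hE//; apply: ge0_subset_integral => //; first exact: mpre.
exact: mphic.
Qed.

(** If Q x (X \ Q) is not charged, the conditional probability of the complement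
    of Q vanishes almost everywhere on Q; its zero set C then has preimage Q up
    to a null set, since that conditional probability integrates to 0 over the
    preimage of C. *)
Lemma relprod_compl_eq0 Q : measurable Q -> relprod Q (~` Q) = 0%R ->
  exists C, [/\ measurable C, mu (Q `\` phi @^-1` C) = 0
    & mu (phi @^-1` C `\` Q) = 0].
Proof.
move=> mQ; have mQc := measurableC mQ; have [h0 mh hE] := cprobP mQc.
set h := cprob (~` Q) in h0 mh hE *.
rewrite /relprod => /eqP; rewrite fine_eq0 ?integral_cprob_fin// => /eqP int0.
have mC : measurable [set y | h y <= 0].
  rewrite -[X in measurable X]setTI; exact: emeasurable_fun_infty_c.
exists [set y | h y <= 0]; split => //.
  have : \int[mu]_(x in Q) `|h (phi x)| = 0.
    by rewrite -[RHS]int0; apply: eq_integral => x _; rewrite gee0_abs.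
  move=> /(ae_eq_integral_abs mu mQ (mphic mh)) [N [mN N0 subN]].
  apply: (subset_measure0 _ mN _ N0); first by apply: measurableD => //; exact: mpre.
  move=> x [Qx /= hx]; apply: subN => /= /(_ Qx) h_eq0.
  by apply: hx; rewrite h_eq0.
rewrite setDE setIC -hE//.
by apply: integral0_eq => x /= hx; apply/eqP; rewrite eq_le hx h0.
Qed.

(** Composing a version of the conditional probability of B with S gives a version
    for the preimage of B under T; the inverse S' serves to write every
    measurable set of Y as a preimage under S. *)
Lemma relprod_invariant (T : X -> X) (S S' : Y -> Y) A B :
  measurable_fun setT T -> measurable_fun setT S -> measurable_fun setT S' ->
  cancel S S' -> cancel S' S ->
  (forall x, phi (T x) = S (phi x)) ->
  (forall A, measurable A -> mu (T @^-1` A) = mu A) ->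
  measurable A -> measurable B ->
  relprod (T @^-1` A) (T @^-1` B) = relprod A B.
Proof.
move=> mT mS mS' SK SK' TS muT mA mB.
have mTpre C : measurable C -> measurable (T @^-1` C).
  by move=> mC; rewrite -[X in measurable X]setTI; exact: mT.
have [h0 mh hE] := cprobP mB.
have chg C : measurable C ->
    \int[mu]_(x in T @^-1` C) cprob B (phi (T x)) =
    \int[mu]_(x in C) cprob B (phi x).
  move=> mC.
  rewrite -(@ge0_integral_pushforward _ _ _ _ _ T mT mu C (cprob B \o phi))//;
    [|exact: mphic|by move=> y _; exact: h0].
  by apply: eq_measure_integral => D mD _; exact: muT.
rewrite (@relprod_cond_prob _ _ (cprob B \o S)); last 3 first.
- exact: mTpre.
- exact: mTpre.
- split=> [y||C mC] /=; [exact: h0|exact: measurableT_comp|].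
  have mC' : measurable (S' @^-1` C).
    by rewrite -[X in measurable X]setTI; exact: mS'.
  have -> : phi @^-1` C = T @^-1` (phi @^-1` (S' @^-1` C)).
    by apply/seteqP; split => x /=; rewrite TS SK.
  under eq_integral do rewrite -TS.
  rewrite chg; last exact: mpre.
  rewrite hE// -preimage_setI muT//; apply: measurableI => //; exact: mpre.
under eq_integral do rewrite /= -TS.
by rewrite chg.
Qed.

End conditional_probability.

(** * Finite partitions and the part of the joining off the diagonal *)

Section offdiagonal.
Context d1 d2 (X : measurableType d1) (Y : measurableType d2) (R : realType).
Variables (mu : {finite_measure set X -> \bar R}) (phi : X -> Y).
Hypothesis mphi : measurable_fun setT phi.
Local Notation lam := (relprod mu phi).
Implicit Types A B : set X.

(** A measurable partition into finitely many pieces, given by the map that sends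
    a point to the index of its piece: common refinements are then pairs. *)
Definition measurable_code (I : finType) (c : X -> I) :=
  forall i, measurable (c @^-1` [set i]).

Lemma measurable_code_preimage (I : finType) (c : X -> I) (S : set I) :
  measurable_code c -> measurable (c @^-1` S).
Proof.
move=> mc.
rewrite (_ : _ @^-1` _ = \bigcup_(i in S) c @^-1` [set i]).
  by apply: fin_bigcup_measurable => // i _; exact: mc.
by apply/seteqP; split => [x Sx|x [i Si /= ->]//]; exists (c x).
Qed.

Lemma additive_code (F : set X -> R) (I : finType) (c : X -> I) A :
  measurable_code c -> measurable A -> F set0 = 0 ->
  (forall A B, measurable A -> measurable B -> A `&` B = set0 ->
    F (A `|` B) = F A + F B) ->
  F A = \sum_i F (A `&` c @^-1` [set i]).
Proof.
move=> mc mA F0 FU.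
suff H (s : seq I) : uniq s -> F (A `&` c @^-1` [set` s]) =
    \sum_(i <- s) F (A `&` c @^-1` [set i]).
  rewrite -big_enum/= -H ?enum_uniq//; congr F.
  by apply/seteqP; split => x /=; [split => //; rewrite mem_enum|case].
elim: s => [|i s IH] /=.
  move=> _; rewrite big_nil (_ : _ `&` _ = set0)//.
  by apply/seteqP; split => // x [_].
move=> /andP[is_ us]; rewrite big_cons -IH// -FU.
- rewrite -setIUr; congr (F (_ `&` _)); apply/seteqP; split => x /=.
    by rewrite inE => /orP[/eqP|]; [left|right].
  by rewrite inE => -[->|->]; rewrite ?eqxx ?orbT.
- by apply: measurableI => //; exact: mc.
- by apply: measurableI => //; exact: measurable_code_preimage.
- apply/seteqP; split => // x [[_ /= ci] [_ /= cs]].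
  by move: is_; rewrite -ci cs.
Qed.

Lemma relprod_codel (I : finType) (c : X -> I) A B :
  measurable_code c -> measurable A -> measurable B ->
  lam A B = \sum_i lam (A `&` c @^-1` [set i]) B.
Proof.
move=> mc mA mB; apply: (@additive_code (fun A => lam A B)) => //.
- exact: relprod0l.
- by move=> *; exact: relprodUl.
Qed.

Lemma relprodUr A B B' : measurable A -> measurable B -> measurable B' ->
  B `&` B' = set0 -> lam A (B `|` B') = lam A B + lam A B'.
Proof.
move=> mA mB mB' BB'; rewrite !(relprodC mu mphi mA)//; last exact: measurableU.
exact: relprodUl.
Qed.

Lemma relprod0r A : measurable A -> lam A set0 = 0.
Proof. by move=> mA; rewrite relprodC// relprod0l. Qed.

Lemma relprod_coder (I : finType) (c : X -> I) A B :
  measurable_code c -> measurable A -> measurable B ->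
  lam A B = \sum_i lam A (B `&` c @^-1` [set i]).
Proof.
move=> mc mA mB; apply: (@additive_code (lam A)) => //.
- exact: relprod0r.
- by move=> *; exact: relprodUr.
Qed.

Lemma le_relprodl A A' B : measurable A -> measurable A' -> measurable B ->
  A `<=` A' -> lam A B <= lam A' B.
Proof.
move=> mA mA' mB AA'; rewrite -(setDUK AA') relprodUl ?setDIK//.
  by rewrite lerDl; exact: relprod_ge0.
exact: measurableD.
Qed.

Lemma le_relprodr A B B' : measurable A -> measurable B -> measurable B' ->
  B `<=` B' -> lam A B <= lam A B'.
Proof.
by move=> mA mB mB' BB'; rewrite !(relprodC mu mphi mA)//; exact: le_relprodl.
Qed.

Lemma relprodTr A : measurable A -> lam A setT = fine (mu A).
Proof. by move=> mA; rewrite relprodC// relprodTl. Qed.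

(** The mass, over A, of the joining outside the union of the squares of the
    pieces. It grows as the partition is refined, and approximates the mass
    over A outside the diagonal. *)
Definition offdiag (I : finType) (c : X -> I) A : R :=
  \sum_i lam (A `&` c @^-1` [set i]) (~` (c @^-1` [set i])).

Section offdiag_code.
Variables (I : finType) (c : X -> I).
Hypothesis mc : measurable_code c.

Let mci i : measurable (~` (c @^-1` [set i])).
Proof. exact/measurableC/mc. Qed.

Lemma offdiag_ge0 A : 0 <= offdiag c A.
Proof. by apply: sumr_ge0 => i _; exact: relprod_ge0. Qed.

Lemma offdiag_le A : measurable A -> offdiag c A <= fine (mu A).
Proof.
move=> mA; rewrite -relprodTr// (relprod_codel mc)//.
apply: ler_sum => i _; apply: le_relprodr => //.
by apply: measurableI => //; exact: mc.
Qed.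

Lemma offdiagU A B : measurable A -> measurable B -> A `&` B = set0 ->
  offdiag c (A `|` B) = offdiag c A + offdiag c B.
Proof.
move=> mA mB AB; rewrite /offdiag -big_split/=; apply: eq_bigr => i _.
rewrite setIUl relprodUl//; try exact: measurableI.
by rewrite setIACA AB set0I.
Qed.

(** Only one of the pieces of c meets a given piece of k, and off-diagonal pairs
    for c are off-diagonal for k. *)
Lemma offdiag_refine (K : finType) (k : X -> K) (h : K -> I) A : measurable_code k ->
  measurable A -> (forall x, c x = h (k x)) -> offdiag c A <= offdiag k A.
Proof.
move=> mk mA chk; rewrite /offdiag.
under eq_bigr => i _ do rewrite (relprod_codel mk (measurableI _ _ mA (mc i)) (mci i)).
rewrite exchange_big /=; apply: ler_sum => j _.
rewrite (bigD1 (h j))//= big1 ?addr0; last first.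
  move=> i ij; rewrite (_ : _ `&` _ = set0) ?relprod0l//.
  apply/seteqP; split => // x [[_ /= cx] kx].
  by move: ij; rewrite -cx chk kx eqxx.
apply: (@le_trans _ _ (lam (A `&` k @^-1` [set j]) (~` (c @^-1` [set h j])))).
  apply: le_relprodl => //.
  - by apply: measurableI => //; apply: measurableI.
  - by apply: measurableI.
  - by move=> x [[]].
apply: le_relprodr => //.
- exact: measurableI.
- exact/measurableC/mk.
- by move=> x /= cx kx; apply: cx; rewrite chk kx.
Qed.

End offdiag_code.

Definition offdiag_set A : set R :=
  [set r | exists (I : finType) (c : X -> I), measurable_code c /\ r = offdiag c A].

(** The marginal of the restriction of the joining to the complement of the
    diagonal. Taking the supremum over all finite partitions, rather than a
    limit along one sequence of partitions, makes its invariance immediate. *)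
Definition offdiag_marginal A : R := sup (offdiag_set A).
Local Notation rho := offdiag_marginal.

Let mcode_unit : measurable_code (fun _ : X => tt).
Proof.
move=> i; rewrite (_ : _ @^-1` _ = setT)//.
by apply/seteqP; split => // x _ /=; case: i.
Qed.

Let offdiag_set_sup A : measurable A -> has_sup (offdiag_set A).
Proof.
move=> mA; split; first by exists (offdiag (fun=> tt) A), unit, (fun=> tt).
by exists (fine (mu A)) => _ [I [c [mc ->]]]; exact: offdiag_le.
Qed.

Lemma offdiag_le_marginal (I : finType) (c : X -> I) A : measurable_code c ->
  measurable A -> offdiag c A <= rho A.
Proof.
move=> mc mA; apply: ub_le_sup; last by exists I, c.
by have [] := offdiag_set_sup mA.
Qed.

Lemma offdiag_marginal_ub A e : measurable A ->
  (forall (I : finType) (c : X -> I), measurable_code c -> offdiag c A <= e) -> rho A <= e.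
Proof.
move=> mA H; apply: ge_sup; first by have [] := offdiag_set_sup mA.
by move=> _ [I [c [mc ->]]]; exact: H.
Qed.

Lemma offdiag_marginal_approx A e : measurable A -> 0 < e ->
  exists (I : finType) (c : X -> I), measurable_code c /\ rho A - e < offdiag c A.
Proof.
move=> mA e0.
have [_ [I [c [mc ->]]] H] := sup_adherent e0 (offdiag_set_sup mA).
by exists I, c.
Qed.

Lemma offdiag_marginal_ge0 A : 0 <= rho A.
Proof.
have [hs|hs] := pselect (has_sup (offdiag_set A)); last by rewrite /rho sup_out.
apply: (@le_trans _ _ (offdiag (fun _ : X => tt) A)).
  exact: offdiag_ge0.
by apply: ub_le_sup; [case: hs|exists unit, (fun=> tt)].
Qed.

Lemma offdiag_marginal_le A : measurable A -> rho A <= fine (mu A).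
Proof.
by move=> mA; apply: offdiag_marginal_ub => // I c mc; exact: offdiag_le.
Qed.

Lemma measurable_code_pair (I J : finType) (c : X -> I) (c' : X -> J) :
  measurable_code c -> measurable_code c' -> measurable_code (fun x => (c x, c' x)).
Proof.
move=> mc mc' [i j].
rewrite (_ : _ @^-1` _ = c @^-1` [set i] `&` c' @^-1` [set j]).
  exact: measurableI.
by apply/seteqP; split => x /= => [[]|[-> ->]].
Qed.

(** Superadditivity holds because partitions that are nearly optimal for A and
    for B have a common refinement. *)
Lemma offdiag_marginalU A B : measurable A -> measurable B -> A `&` B = set0 ->
  rho (A `|` B) = rho A + rho B.
Proof.
move=> mA mB AB; have mAB := measurableU _ _ mA mB.
apply/eqP; rewrite eq_le; apply/andP; split.
  apply: offdiag_marginal_ub => // I c mc; rewrite offdiagU//.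
  by apply: lerD; exact: offdiag_le_marginal.
apply/ler_addgt0Pr => e e0; have e2 : 0 < e / 2 by rewrite divr_gt0.
have [I [c [mc Hc]]] := offdiag_marginal_approx mA e2.
have [J [c' [mc' Hc']]] := offdiag_marginal_approx mB e2.
have mcc := measurable_code_pair mc mc'.
have H1 := @offdiag_refine _ _ mc _ (fun x => (c x, c' x)) fst A mcc mA (fun=> erefl).
have H2 := @offdiag_refine _ _ mc' _ (fun x => (c x, c' x)) snd B mcc mB (fun=> erefl).
have H3 := offdiag_le_marginal mcc mAB.
move: H3; rewrite offdiagU// => H3; lra.
Qed.

Lemma offdiag_marginal0 : rho set0 = 0.
Proof.
apply/eqP; rewrite eq_le offdiag_marginal_ge0 andbT.
by rewrite (le_trans (offdiag_marginal_le _))// measure0.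
Qed.

(** Finite additivity and domination by mu suffice: the mass of the tail of a
    disjoint union tends to 0 because its mu-mass does. *)
Lemma offdiag_marginal_sigma_additive :
  semi_sigma_additive (fun A => (rho A)%:E).
Proof.
move=> F mF tF mUF.
have fmu A : measurable A -> (mu A = (fine (mu A))%:E)%E.
  by move=> mA; rewrite fineK// fin_num_measure.
pose V n := \bigcup_(k in [set k | (n <= k)%N]) F k.
have mV n : measurable (V n) by apply: bigcup_measurable.
have VS n : V n = F n `|` V n.+1.
  apply/seteqP; split => x.
    move=> [k /= nk Fx]; have [->|nk'] := eqVneq n k; first by left.
    by right; exists k => //=; rewrite ltn_neqAle nk' nk.
  by move=> [Fx|[k /= nk Fx]]; [exists n => /=|exists k => //=; exact: ltnW].
have FV n : F n `&` V n.+1 = set0.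
  apply/seteqP; split => // x [Fx [k /= nk Fkx]].
  move/trivIsetP : tF => /(_ n k I I); rewrite ltn_eqF// => /(_ isT).
  by move=> H; have : (F n `&` F k) x by []; rewrite H.
(* Splitting off finitely many terms; applied to mu and to its off-diagonal marginal. *)
have tail (G : set X -> R) n : (forall A B, measurable A -> measurable B ->
    A `&` B = set0 -> G (A `|` B) = G A + G B) ->
    G (\bigcup_k F k) = \sum_(0 <= i < n) G (F i) + G (V n).
  move=> GU; elim: n => [|n IH].
    by rewrite big_geq// add0r; congr G; apply: eq_bigcupl; split => k.
  by rewrite IH VS GU// big_nat_recr//= addrA.
have muU A B : measurable A -> measurable B -> A `&` B = set0 ->
    fine (mu (A `|` B)) = fine (mu A) + fine (mu B).
  by move=> mA mB AB; rewrite measureU// fineD// fin_num_measure.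
have rhoE n := tail rho n offdiag_marginalU.
have muE n := tail (fine \o mu) n muU.
have muV : (fun n => fine (mu (V n))) @ \oo --> 0.
  have /fine_cvgP[_ +] : (fun n => \sum_(0 <= i < n) mu (F i))%E @ \oo -->
      (fine (mu (\bigcup_k F k)))%:E.
    rewrite -(fmu _ mUF).
    by have := @measure_semi_sigma_additive _ _ _ mu F mF tF mUF.
  move=> mucvg; rewrite -(subrr (fine (mu (\bigcup_k F k)))).
  apply: cvg_trans (cvgB (cvg_cst (fine (mu (\bigcup_k F k)))) mucvg).
  apply: near_eq_cvg; near=> n; rewrite !fctE /=.
  rewrite -sum_fine => [|i _]; last by rewrite fin_num_measure.
  by have /= -> := muE n; rewrite addrC addKr.
have rhoV : (fun n => rho (V n)) @ \oo --> 0.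
  apply: (@squeeze_cvgr _ _ _ _ (cst 0) (fun n => fine (mu (V n)))) => //.
    by near=> n; rewrite offdiag_marginal_ge0 offdiag_marginal_le.
  exact: cvg_cst.
under eq_fun do rewrite sumEFin.
apply: cvg_EFin; first by near=> n.
rewrite /comp /=.
rewrite -[X in _ --> X]subr0.
apply: cvg_trans (cvgB (cvg_cst (rho (\bigcup_k F k))) rhoV).
apply: near_eq_cvg; near=> n; rewrite !fctE /=.
by rewrite [in LHS](rhoE n) addrK.
Unshelve. all: by end_near. Qed.

Definition offdiag_marginal_measure (A : set X) : \bar R := (rho A)%:E.

Let offdiag_marginal_measure0 : offdiag_marginal_measure set0 = 0%E.
Proof. by rewrite /offdiag_marginal_measure offdiag_marginal0. Qed.

Let offdiag_marginal_measure_ge0 A : (0 <= offdiag_marginal_measure A)%E.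
Proof. by rewrite lee_fin offdiag_marginal_ge0. Qed.

HB.instance Definition _ := isMeasure.Build _ _ _ offdiag_marginal_measure
  offdiag_marginal_measure0 offdiag_marginal_measure_ge0
  offdiag_marginal_sigma_additive.

Lemma offdiag_marginal_eq0 Q : measurable Q -> rho setT = 0 ->
  lam Q (~` Q) = 0.
Proof.
(* The partition into Q and its complement. *)
move=> mQ rho0; pose c x := `[< Q x >].
have cT : c @^-1` [set true] = Q.
  by apply/seteqP; split => x /=; [move/asboolP|move=> Qx; apply/asboolP].
have cF : c @^-1` [set false] = ~` Q.
  by apply/seteqP; split => x /=; [move/asboolP|move=> Qx; apply/asboolP].
have mc : measurable_code c by case; rewrite ?cT ?cF//; exact: measurableC.
have := offdiag_le_marginal mc measurableT; rewrite rho0.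
rewrite /offdiag big_bool /= !setTI cT cF => H.
have H1 := relprod_ge0 mu mphi Q (measurableC mQ).
have H2 := relprod_ge0 mu mphi (~` Q) (measurableC (measurableC mQ)).
by apply/eqP; rewrite eq_le H1 andbT; lra.
Qed.

Section invariance.

Let offdiag_marginal_invariant_le (T : X -> X) (S S' : Y -> Y) A :
  measurable_fun setT T -> measurable_fun setT S -> measurable_fun setT S' ->
  cancel S S' -> cancel S' S ->
  (forall x, phi (T x) = S (phi x)) ->
  (forall A, measurable A -> mu (T @^-1` A) = mu A) ->
  measurable A -> rho A <= rho (T @^-1` A).
Proof.
move=> mT mS mS' SK SK' TS muT mA.
have mTpre C : measurable C -> measurable (T @^-1` C).
  by move=> mC; rewrite -[X in measurable X]setTI; exact: mT.
apply: offdiag_marginal_ub => // I c mc.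
have mcT : measurable_code (c \o T) by move=> i; rewrite comp_preimage; exact/mTpre/mc.
apply: le_trans (offdiag_le_marginal mcT (mTpre _ mA)).
rewrite le_eqVlt; apply/orP; left; apply/eqP; apply: eq_bigr => i _.
rewrite -(relprod_invariant mphi mT mS mS' SK SK' TS muT)//.
- by apply: measurableI => //; exact: mc.
- exact/measurableC/mc.
Qed.

Lemma offdiag_marginal_invariant (T T' : X -> X) (S S' : Y -> Y) A :
  measurable_fun setT T -> measurable_fun setT T' ->
  measurable_fun setT S -> measurable_fun setT S' ->
  cancel T T' -> cancel T' T -> cancel S S' -> cancel S' S ->
  (forall x, phi (T x) = S (phi x)) ->
  (forall A, measurable A -> mu (T @^-1` A) = mu A) ->
  measurable A -> rho (T @^-1` A) = rho A.
Proof.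
move=> mT mT' mS mS' TK TK' SK SK' TS muT mA.
have mTpre C : measurable C -> measurable (T @^-1` C).
  by move=> mC; rewrite -[X in measurable X]setTI; exact: mT.
have mTpre' C : measurable C -> measurable (T' @^-1` C).
  by move=> mC; rewrite -[X in measurable X]setTI; exact: mT'.
apply/eqP; rewrite eq_le; apply/andP; split; last first.
  exact: (@offdiag_marginal_invariant_le T S S').
have -> : rho A = rho (T' @^-1` (T @^-1` A)).
  by congr rho; apply/seteqP; split => x /=; rewrite TK'.
apply: (@offdiag_marginal_invariant_le T' S' S) => //.
- by move=> x; rewrite -{2}(TK' x) TS SK.
- move=> B mB; rewrite -muT; last exact: mTpre'.
  by congr (mu _); apply/seteqP; split => x /=; rewrite TK.
- exact: mTpre.
Qed.

End invariance.
End offdiagonal.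

(** * Metric spaces, Borel sets and regularity *)

Section metric_topology.
Context (R : realType) (X : metricType R).
Implicit Types (x y : X) (e : R).

Lemma nbhs_mdist x (A : set X) :
  nbhs x A <-> exists2 e, 0 < e & forall y, mdist x y < e -> A y.
Proof.
rewrite -nbhs_ballE; split=> [[e /= e0 H]|[e e0 H]]; exists e => // y.
  by move=> xy; apply: H; rewrite ballEmdist.
by rewrite ballEmdist; exact: H.
Qed.

Lemma mdist_lipschitz x y x' y' :
  `|mdist x y - mdist x' y'| <= mdist x x' + mdist y y'.
Proof.
have H1 := metric_triangle x x' y; have H2 := metric_triangle x' y' y.
have H3 := metric_triangle x' x y'; have H4 := metric_triangle x y y'.
rewrite (metric_sym y' y) in H2; rewrite (metric_sym x' x) in H3.
rewrite ler_norml; apply/andP; split; lra.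
Qed.

Lemma mdist_continuous : continuous (fun p : X * X => mdist p.1 p.2).
Proof.
move=> [x y]; apply/cvgrPdist_lt => e e0 /=.
have e2 : 0 < e / 2 by rewrite divr_gt0.
exists ([set z | mdist x z < e / 2], [set z | mdist y z < e / 2]).
  by split; apply/nbhs_mdist; exists (e / 2).
move=> [x' y'] [/= xx' yy']; apply: le_lt_trans (mdist_lipschitz _ _ _ _) _.
lra.
Qed.

Lemma open_mdist_lt x e : open [set y | mdist x y < e].
Proof.
rewrite openE => y /= xy; apply/nbhs_mdist; exists (e - mdist x y).
  by rewrite subr_gt0.
move=> z yz /=; apply: le_lt_trans (metric_triangle x y z) _.
by rewrite addrC -ltrBrDr.
Qed.

End metric_topology.

(** The image of K is compact, hence closed, and misses 0. *)
Lemma compact_positive_lb (R : realType) (Z : topologicalType) (K : set Z)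
    (g : Z -> R) : compact K -> continuous g -> (forall z, K z -> 0 < g z) ->
  exists2 e, 0 < e & forall z, K z -> e <= g z.
Proof.
move=> cK cg gpos.
have cgK : closed (g @` K).
  apply: compact_closed; first exact: Rhausdorff.
  by apply: continuous_compact => //; exact: continuous_subspaceT.
have : nbhs 0 (~` (g @` K)).
  apply: open_nbhs_nbhs; split; first exact: closed_openC.
  by move=> [z /gpos + gz]; rewrite gz ltxx.
move=> /nbhs_ballP[e /= e0 H]; exists e => // z Kz; rewrite leNgt; apply/negP => ge.
apply: (H (g z)); last by exists z.
by rewrite /ball/= sub0r normrN gtr0_norm// gpos.
Qed.

Section borel_sets.
Context (X : topologicalType) (x0 : X).
Notation bX := (borel x0).

Lemma open_borel (A : set X) : open A -> measurable (A : set bX).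
Proof. exact: sub_sigma_algebra. Qed.

Lemma closed_borel (A : set X) : closed A -> measurable (A : set bX).
Proof.
by move=> cA; rewrite -(setCK A); apply: measurableC; apply: open_borel; exact: closed_openC.
Qed.

Lemma continuous_borel (Y : topologicalType) (y0 : Y) (f : X -> Y) :
  continuous f -> measurable_fun setT (f : bX -> borel y0).
Proof.
move=> /continuousP cf; apply: (@measurability _ _ bX (borel y0) setT f open) => //.
by move=> _ [B oB <-]; rewrite setTI; apply: open_borel; exact: cf.
Qed.

End borel_sets.

Section regularity.
Context (R : realType) (X : metricType R) (x0 : X).
Notation bX := (borel x0).
Variable mu : {finite_measure set bX -> \bar R}.

Lemma measure_cvg0_lt (F : nat -> set bX) e : (forall n, measurable (F n)) ->
  (forall m n, (m <= n)%N -> F n `<=` F m) -> \bigcap_n F n = set0 ->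
  0 < e -> exists n, (mu (F n) < e%:E)%E.
Proof.
move=> mF decF F0 e0.
have /= : mu \o F @ \oo --> mu (\bigcap_n F n).
  apply: nonincreasing_cvg_mu => //.
  - by rewrite -ge0_fin_numE ?measure_ge0// fin_num_measure.
  - exact: bigcap_measurable.
  - by move=> m n mn; apply/subsetPset; exact: decF.
rewrite F0 measure0 => /fine_cvgP[_ /cvgrPdist_lt/(_ e e0)[n _ /(_ n (leqnn n))]].
rewrite /= sub0r normrN ger0_norm; last by rewrite fine_ge0.
move=> H; exists n; rewrite -lte_fin fineK// in H.
exact: fin_num_measure.
Qed.

Let approximable (A : set X) := measurable (A : set bX) /\
  forall e, 0 < e -> exists K U : set X, [/\ closed K, open U, K `<=` A, A `<=` U
    & (mu (U `\` K) < e%:E)%E].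

Let approximable_open A : open A -> approximable A.
Proof.
move=> oA; split => [|e e0]; first exact: open_borel.
pose W n := \bigcup_(y in ~` A) [set z | mdist y z < n.+1%:R^-1 :> R].
have oW n : open (W n) by apply: bigcup_open => y _; exact: open_mdist_lt.
have [|||n Hn] := @measure_cvg0_lt (fun n => A `&` W n) e _ _ _ e0.
- by move=> n; apply: measurableI; exact: open_borel.
- move=> m n mn x [Ax [y Ay /= yx]]; split => //; exists y => //=.
  by apply: lt_le_trans yx _; rewrite lef_pV2 ?posrE// ler_nat.
- apply/seteqP; split => // x H.
  have [Ax _] := H 0%N I.
  have /nbhs_mdist[r r0 Hr] : nbhs x A by exact: open_nbhs_nbhs.
  have [n rn] : exists n, n.+1%:R^-1 < r.
    exists (Num.truncn r^-1).
    by rewrite -ltf_pV2 ?(posrE,divr_gt0)// invrK truncnS_gt.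
  have [_ [y Ay /= yx]] := H n I; apply: Ay; apply: Hr.
  by rewrite metric_sym (lt_trans yx).
exists (~` W n), A; split => //; first exact: open_closedC.
- move=> x Wx; apply: contrapT => Ax; apply: Wx; exists x => //=.
  by rewrite mdistxx.
- by rewrite setDE setCK.
Qed.

Let approximableC A : approximable A -> approximable (~` A).
Proof.
move=> [mA H]; split => [|e e0]; first exact: measurableC.
have [K [U [cK oU KA AU KU]]] := H e e0.
exists (~` U), (~` K); split.
- exact: open_closedC.
- exact: closed_openC.
- exact: subsetC.
- exact: subsetC.
- by rewrite setDE setCK setIC -setDE.
Qed.

Let approximable_bigcup (A : nat -> set X) : (forall n, approximable (A n)) ->
  approximable (\bigcup_n A n).
Proof.
move=> HA; split => [|e e0].
  by apply: bigcup_measurable => n _; have [] := HA n.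
have e4 : 0 < e / 2 by rewrite divr_gt0.
have /choice[KU HKU] n : exists KU : set X * set X, [/\ closed KU.1, open KU.2,
    KU.1 `<=` A n, A n `<=` KU.2
    & (mu (KU.2 `\` KU.1) < (e / 2 / (2 ^ n.+1)%:R)%:E)%E].
  have [_ /(_ (e / 2 / (2 ^ n.+1)%:R))] := HA n.
  by rewrite divr_gt0 ?ltr0n ?expn_gt0// => /(_ isT)[K [U ?]]; exists (K, U).
pose K n := (KU n).1; pose U n := (KU n).2.
have mK n : measurable (K n : set bX).
  by apply: closed_borel; have [] := HKU n.
have mU n : measurable (U n : set bX).
  by apply: open_borel; have [] := HKU n.
pose L n : set bX := \bigcup_(i < n) K i.
pose KK : set bX := \bigcup_n K n.
have mL n : measurable (L n) by exact: bigcup_measurable.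
have mKK : measurable KK by exact: bigcup_measurable.
have [|||N HN] := @measure_cvg0_lt (fun n => KK `\` L n) (e / 2) _ _ _ e4.
- by move=> n; exact: measurableD.
- move=> m n mn x [Kx Lx]; split => // -[i /= im Kix]; apply: Lx; exists i => //=.
  exact: leq_trans mn.
- by apply/seteqP; split => // x H; have [[i _ Kix] _] := H 0%N I;
    have [_] := H i.+1 I; apply; exists i => /=.
exists (L N), (\bigcup_n U n); split.
- apply: closed_bigcup => // i _; by have [] := HKU i.
- by apply: bigcup_open => i _; have [] := HKU i.
- by move=> x [i _ Kx]; exists i => //; have [_ _ + _ _] := HKU i; exact.
- by move=> x [i _ Ax]; exists i => //; have [_ _ _ + _] := HKU i; exact.
have mUK : measurable (\bigcup_n (U n `\` K n) : set bX).
  by apply: bigcup_measurable => n _; exact: measurableD.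
have mD : measurable ((\bigcup_n (U n `\` K n)) `|` (KK `\` L N) : set bX).
  by apply: measurableU => //; exact: measurableD.
apply: (@le_lt_trans _ _ (mu ((\bigcup_n (U n `\` K n)) `|` (KK `\` L N)))).
  apply: le_measure; rewrite ?inE//.
    by apply: measurableD => //; exact: bigcup_measurable.
  move=> x [[i _ Ux] Lx]; have [Kx|Kx] := pselect (KK x); first by right.
  by left; exists i => //; split => // Kix; apply: Kx; exists i.
apply: (@le_lt_trans _ _ (mu (\bigcup_n (U n `\` K n)) + mu (KK `\` L N))%E).
  by apply: measureU2 => //; exact: measurableD.
rewrite (splitr e) EFinD; apply: lee_ltD => //.
- by apply: fin_num_measure.
- apply: (@le_trans _ _ (\sum_(0 <= n <oo) mu (U n `\` K n))%E).
    by apply: measure_sigma_subadditive => // n; exact: measurableD.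
  apply: le_trans (epsilon_trick0 xpredT (ltW e4)).
  by apply: lee_nneseries => // n _; apply: ltW; have [] := HKU n.
Qed.

(** The sets squeezed between a closed and an open set whose difference has small
    measure form a sigma-algebra, which contains the open sets since an open
    set of a metric space is an increasing union of closed sets. *)
Lemma closed_inner_regular (A : set bX) e : measurable A -> 0 < e ->
  exists K : set X, [/\ closed K, K `<=` A & (mu (A `\` K) < e%:E)%E].
Proof.
move=> mA e0.
have [_ /(_ e e0)[K [U [cK oU KA AU KU]]]] : approximable A.
  have : <<s (@open X : set (set X)) >> A by exact: mA.
  move: A {mA}; apply: smallest_sub; last exact: approximable_open.
  split.
  - by apply: approximable_open; exact: open0.
  - by move=> A HA; rewrite setTD; exact: approximableC.
  - exact: approximable_bigcup.
exists K; split => //; apply: le_lt_trans KU; apply: le_measure; rewrite ?inE.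
- by apply: measurableD => //; exact: closed_borel.
- by apply: measurableD; [exact: open_borel|exact: closed_borel].
- by move=> x [Ax Kx]; split => //; exact: AU.
Qed.

End regularity.

(** * Multiplicities of covers against the joining *)

Section multiplicity.
Context (X : Type) (J : finType) (V : J -> set X).

Definition hits (x : X) : {set J} := [set j | `[< V j x >]].

Definition multiplicity x := #|hits x|.

Lemma in_hits x j : (j \in hits x) <-> V j x.
Proof. by rewrite inE; split => /asboolP. Qed.

End multiplicity.

Section offdiagonal_multiplicity.
Context d1 d2 (X : measurableType d1) (Y : measurableType d2) (R : realType).
Variables (mu : {finite_measure set X -> \bar R}) (phi : X -> Y).
Hypothesis mphi : measurable_fun setT phi.
Local Notation lam := (relprod mu phi).
Implicit Types A B : set X.

Lemma relprod_split A B N : measurable A -> measurable B -> measurable N ->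
  lam A B <= lam (A `&` N) B + lam A (B `&` N) + lam (A `\` N) (B `\` N).
Proof.
move=> mA mB mN.
have mAN := measurableI _ _ mA mN; have mBN := measurableI _ _ mB mN.
have mAN' := measurableD mA mN; have mBN' := measurableD mB mN.
have disj (C : set X) : (C `&` N) `&` (C `\` N) = set0.
  by apply/seteqP; split => // x [[_ Nx] [_]].
rewrite -{1}(setUIDK A N) relprodUl// -addrA lerD2l.
rewrite -{1}(setUIDK B N) relprodUr// lerD2r.
exact: le_relprodl.
Qed.

(** Both marginals of the off-diagonal part agree, because the joining and the
    union of the squares are symmetric. *)
Lemma offdiag_swap (I : finType) (c : X -> I) B : measurable_code c -> measurable B ->
  \sum_i lam (c @^-1` [set i]) (~` (c @^-1` [set i]) `&` B) = offdiag mu phi c B.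
Proof.
move=> mc mB.
have mci i : measurable (c @^-1` [set i]) := mc i.
have mciC i : measurable (~` (c @^-1` [set i])) by exact: measurableC.
have mBi i : measurable (B `&` c @^-1` [set i]) by exact: measurableI.
have E1 i : lam (c @^-1` [set i]) B = lam (c @^-1` [set i]) (B `&` c @^-1` [set i])
    + lam (c @^-1` [set i]) (~` (c @^-1` [set i]) `&` B).
  rewrite (setIC (~` _)) -relprodUr//.
  - by rewrite -setIUr setUv setIT.
  - exact: measurableI.
  - by rewrite setIACA setICr setI0.
have E2 i : lam (B `&` c @^-1` [set i]) setT = lam (B `&` c @^-1` [set i]) (c @^-1` [set i])
    + lam (B `&` c @^-1` [set i]) (~` (c @^-1` [set i])).
  by rewrite -relprodUr// ?setUv// setICr.
have : \sum_i lam (c @^-1` [set i]) B = \sum_i lam (B `&` c @^-1` [set i]) setT.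
  rewrite -(relprod_codel mu mphi mc)//.
  under eq_bigr => i _ do rewrite -(setTI (c @^-1` [set i])).
  rewrite -(relprod_codel mu mphi mc)//.
  by rewrite relprodC.
rewrite (eq_bigr _ (fun i _ => E1 i)) (eq_bigr _ (fun i _ => E2 i)) !big_split/=.
under eq_bigr => i _ do rewrite (relprodC mu mphi (mci i) (mBi i)).
by move/addrI.
Qed.

Section hits.
Variables (J : finType) (V : J -> set X).
Hypothesis mV : forall j, measurable (V j).

Lemma measurable_code_hits : measurable_code (hits V).
Proof.
move=> S.
rewrite (_ : _ @^-1` _ = \bigcap_(j in [set: J]) (if j \in S then V j else ~` V j)).
  apply: fin_bigcap_measurable => // j _.
  by case: ifP => _ //; exact: measurableC.
apply/seteqP; split => x /=.
  by move=> <- j _; case: ifPn => [/in_hits//|/negP jx]; move/in_hits.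
move=> H; apply/setP => j; apply/idP/idP => [/in_hits Vx|jS].
  by have := H j I; case: ifPn.
by have := H j I; rewrite jS => /in_hits.
Qed.

(** Summing over the atoms of the family V, each counted as often as V covers it,
    counts each V j once. *)
Lemma additive_multiplicity (F : set X -> R) : F set0 = 0 ->
  (forall A B, measurable A -> measurable B -> A `&` B = set0 ->
    F (A `|` B) = F A + F B) ->
  \sum_(S : {set J}) #|S|%:R * F (hits V @^-1` [set S]) = \sum_j F (V j).
Proof.
move=> F0 FU; have mh := measurable_code_hits.
under [RHS]eq_bigr => j _ do rewrite (additive_code mh (mV j) F0 FU).
rewrite exchange_big /=; apply: eq_bigr => S _.
rewrite -sum1_card natr_sum mulr_suml big_mkcond/=; apply: eq_bigr => j _.
case: ifPn => jS; last first.
  rewrite (_ : _ `&` _ = set0)//; apply/seteqP; split => // x [/in_hits + /= hS].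
  by rewrite hS (negbTE jS).
rewrite mul1r; congr F; apply/seteqP; split => x /=; last by case.
by move=> hS; split => //; apply/in_hits; rewrite hS.
Qed.

End hits.

(** A Markov inequality for the sum of the multiplicities at the two coordinates
    of a pair, against the part of the joining off the squares of c. Pairs with
    sum at least d are charged to the two marginals, whence the factor 2; pairs
    with a smaller sum are only charged when a coordinate lies in N. *)
Lemma offdiag_multiplicity (I J : finType) (c : X -> I) (V : J -> set X) N d :
  measurable_code c -> (forall j, measurable (V j)) -> measurable N ->
  (forall i (S S' : {set J}), (#|S| + #|S'| < d)%N ->
    lam (c @^-1` [set i] `&` hits V @^-1` [set S] `\` N)
        (~` (c @^-1` [set i]) `&` hits V @^-1` [set S'] `\` N) = 0) ->
  d%:R * offdiag mu phi c setT <=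
    2 * \sum_j offdiag mu phi c (V j) + 2 * d%:R * offdiag mu phi c N.
Proof.
move=> mc mV mN lam0; have mh := measurable_code_hits mV.
have mci i : measurable (c @^-1` [set i]) := mc i.
have mciC i : measurable (~` (c @^-1` [set i])) by exact: measurableC.
have mhS S : measurable (hits V @^-1` [set S]) := mh S.
have sum2 A B : measurable A -> measurable B -> lam A B =
    \sum_S \sum_S' lam (A `&` hits V @^-1` [set S]) (B `&` hits V @^-1` [set S']).
  move=> mA mB; rewrite (relprod_codel mu mphi mh)//; apply: eq_bigr => S _.
  by rewrite (relprod_coder mu mphi mh)//; exact: measurableI.
pose P i S S' := lam (c @^-1` [set i] `&` hits V @^-1` [set S])
                     (~` (c @^-1` [set i]) `&` hits V @^-1` [set S']).
pose P1 i S S' := lam (c @^-1` [set i] `&` N `&` hits V @^-1` [set S])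
                     (~` (c @^-1` [set i]) `&` hits V @^-1` [set S']).
pose P2 i S S' := lam (c @^-1` [set i] `&` hits V @^-1` [set S])
                     (~` (c @^-1` [set i]) `&` N `&` hits V @^-1` [set S']).
have main i S S' : d%:R * P i S S' <=
    #|S|%:R * P i S S' + #|S'|%:R * P i S S' + d%:R * P1 i S S' + d%:R * P2 i S S'.
  have P0 : 0 <= P i S S' by apply: relprod_ge0 => //; exact: measurableI.
  have P10 : 0 <= P1 i S S' by apply: relprod_ge0 => //; exact: measurableI.
  have P20 : 0 <= P2 i S S'.
    by apply: relprod_ge0 => //; apply: measurableI => //; exact: measurableI.
  rewrite -mulrDl -natrD -addrA -mulrDr.
  have [dS|dS] := leqP d (#|S| + #|S'|).
    apply: (@le_trans _ _ ((#|S| + #|S'|)%N%:R * P i S S')).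
      by rewrite ler_wpM2r// ler_nat.
    by rewrite lerDl mulr_ge0// addr_ge0.
  rewrite -[leLHS]add0r lerD ?mulr_ge0// ler_wpM2l//.
  apply: le_trans (relprod_split _ _ mN) _; try exact: measurableI.
  by rewrite lam0// addr0 /P1 /P2 !(setIAC _ N).
have -> : d%:R * offdiag mu phi c setT = \sum_i \sum_S \sum_S' d%:R * P i S S'.
  rewrite /offdiag mulr_sumr; apply: eq_bigr => i _.
  rewrite setTI sum2// mulr_sumr; apply: eq_bigr => S _.
  by rewrite mulr_sumr.
have : \sum_i \sum_S \sum_S' d%:R * P i S S' <= \sum_i \sum_(S : {set J}) \sum_(S' : {set J})
    (#|S|%:R * P i S S' + #|S'|%:R * P i S S' + d%:R * P1 i S S' + d%:R * P2 i S S').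
  by do 3!(apply: ler_sum => ? _); exact: main.
move=> /le_trans; apply.
have sum3D (F G : I -> {set J} -> {set J} -> R) :
    \sum_i \sum_S \sum_S' (F i S S' + G i S S') =
    \sum_i \sum_S \sum_S' F i S S' + \sum_i \sum_S \sum_S' G i S S'.
  rewrite -big_split; apply: eq_bigr => i _; rewrite -big_split.
  by apply: eq_bigr => S _; rewrite -big_split.
rewrite !sum3D.
have -> : \sum_i \sum_(S : {set J}) \sum_(S' : {set J}) #|S|%:R * P i S S' =
    \sum_j offdiag mu phi c (V j).
  rewrite [RHS]exchange_big/=; apply: eq_bigr => i _.
  rewrite -(@additive_multiplicity _ V mV
    (fun A => lam (A `&` c @^-1` [set i]) (~` (c @^-1` [set i])))).
  - apply: eq_bigr => S _; rewrite -mulr_sumr; congr (_ * _).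
    rewrite -(relprod_coder mu mphi mh)//; last exact: measurableI.
    by rewrite setIC.
  - by rewrite set0I relprod0l.
  - move=> A B mA mB AB; rewrite setIUl relprodUl//; try exact: measurableI.
    by rewrite setIACA AB set0I.
have -> : \sum_i \sum_(S : {set J}) \sum_(S' : {set J}) #|S'|%:R * P i S S' =
    \sum_j offdiag mu phi c (V j).
  under [RHS]eq_bigr => j _ do rewrite -offdiag_swap//.
  rewrite [RHS]exchange_big/=; apply: eq_bigr => i _.
  rewrite -(@additive_multiplicity _ V mV
    (fun A => lam (c @^-1` [set i]) (~` (c @^-1` [set i]) `&` A))).
  - rewrite exchange_big; apply: eq_bigr => S' _; rewrite -mulr_sumr; congr (_ * _).
    by rewrite -(relprod_codel mu mphi mh)//; exact: measurableI.
  - by rewrite setI0 relprod0r.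
  - move=> A B mA mB AB; rewrite setIUr relprodUr//; try exact: measurableI.
    by rewrite setIACA AB setI0.
have -> : \sum_i \sum_S \sum_S' d%:R * P1 i S S' = d%:R * offdiag mu phi c N.
  rewrite /offdiag mulr_sumr; apply: eq_bigr => i _.
  rewrite setIC sum2//; last exact: measurableI.
  rewrite mulr_sumr; apply: eq_bigr => S _.
  by rewrite mulr_sumr.
have -> : \sum_i \sum_S \sum_S' d%:R * P2 i S S' = d%:R * offdiag mu phi c N.
  rewrite -offdiag_swap// mulr_sumr; apply: eq_bigr => i _.
  rewrite sum2//; last exact: measurableI.
  rewrite mulr_sumr; apply: eq_bigr => S _.
  by rewrite mulr_sumr.
by rewrite le_eqVlt; apply/orP; left; apply/eqP; ring.
Qed.

End offdiagonal_multiplicity.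

(** * The joining of an invariant measure is carried by the diagonal *)

Lemma compact_finite_subcover (X : topologicalType) (W : X -> set X) :
  compact [set: X] -> (forall y, open (W y)) -> (forall y, W y y) ->
  exists s : seq X, forall x, exists2 y, y \in s & W y x.
Proof.
move=> cX oW W_self; have [[x0 _]|X0] := pselect (exists x : X, True); last first.
  by exists [::] => x; case: X0; exists x.
pose PX : ptopologicalType :=
  HB.pack (Topological.sort X) (isPointed.Build (Topological.sort X) x0).
have : cover_compact [set: PX] by rewrite -compact_cover.
move=> /(_ PX setT W) [y _|x _|D _ cD]; first exact: oW.
  by exists x => //; exact: W_self.
by exists (finmap.enum_fset D) => x; have [y yD yx] := cD x I; exists y.
Qed.

Lemma compact_finite_net (R : realType) (X : metricType R) (e : R) :
  compact [set: X] -> 0 < e ->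
  exists s : seq X, forall x, exists2 y, y \in s & mdist y x < e.
Proof.
move=> cX e0.
apply: (@compact_finite_subcover X (fun y => [set x | mdist y x < e])) => // y.
  exact: open_mdist_lt.
by rewrite /= mdistxx.
Qed.

Section dynamical_systems.
Context (Gamma : groupType) (X : topologicalType) (T : Gamma -> X -> X).
Hypothesis T_ds : dynamical_system T.

Lemma ds_continuous g : continuous (T g).
Proof. by have [] := ds_homeo T_ds g. Qed.

(** T 1 is an idempotent bijection. *)
Lemma ds1 x : T 1%g x = x.
Proof.
have [_ [h [_ hK _]]] := ds_homeo T_ds 1%g.
by apply: (can_inj hK); rewrite -(ds_mul T_ds) mulg1.
Qed.

Lemma dsK g : cancel (T g) (T g^-1%g).
Proof. by move=> x; rewrite -(ds_mul T_ds) mulVg ds1. Qed.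

Lemma dsKV g : cancel (T g^-1%g) (T g).
Proof. by move=> x; rewrite -(ds_mul T_ds) mulgV ds1. Qed.

End dynamical_systems.

(** The sum of the measures of the V j is the integral of the multiplicity of V,
    that is, of its order plus 1. *)
Definition invariant_multiplicity_le (R : realType) (Gamma : groupType)
    (X : topologicalType) (T : Gamma -> X -> X) (b : R) (J : finType)
    (V : J -> set X) : Prop :=
  forall nu : borel_prob R X, invariant_prob T nu ->
    \sum_j fine (nu (V j)) <= b.

(** The numerical contradiction behind offdiag_marginalT_eq0: when twice the mean
    multiplicity b is below D, Markov's inequality leaves room for an error
    eta. *)
Lemma offdiag_gap (R : realFieldType) (D k b s t u : R) :
  0 < D -> 0 < k * (D - 2 * b) -> s <= k * b ->
  let eta := k * (D - 2 * b) / (4 * D) in k - eta < t -> u <= eta ->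
  2 * s + 2 * D * u < D * t.
Proof.
move=> D0 gap sk eta ket ueta.
have etaE : D * eta = k * (D - 2 * b) / 4 by rewrite /eta; field; rewrite gt_eqF.
have H1 : D * (k - eta) < D * t by rewrite ltr_pM2l.
have H2 : D * u <= D * eta by rewrite ler_pM2l.
move: H1; rewrite mulrBr -mulrA => H1; lra.
Qed.

Section injectivity_criterion.
Context (R : realType) (Gamma : groupType) (X : metricType R)
  (Y : topologicalType) (T : Gamma -> X -> X) (S : Gamma -> Y -> Y)
  (phi : X -> Y) (d : nat) (b : R).
Hypotheses (T_ds : dynamical_system T) (S_ds : dynamical_system S)
  (hausY : hausdorff_space Y) (cphi : continuous phi)
  (phi_equi : forall g x, phi (T g x) = S g (phi x)) (d_gt0 : (0 < d)%N) (b_lt : 2 * b < d%:R).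
Hypothesis covers : forall e : R, 0 < e -> exists (J : finType) (V : J -> set X),
  [/\ forall j, open (V j), invariant_multiplicity_le T b V
    & forall x x', (multiplicity V x + multiplicity V x' < d)%N ->
        phi x = phi x' -> mdist x x' < e].

Section measure.
Variable mu : borel_prob R X.
Hypothesis mu_inv : invariant_prob T mu.

Let x0 := bp_point mu.
Let bX := borel x0.
Let bY := borel (phi x0).
Let m : {finite_measure set bX -> \bar R} := bp_measure mu.
Let phi' : bX -> bY := phi.

Let mphi : measurable_fun setT phi'. Proof. exact: continuous_borel. Qed.

Let mT g : measurable_fun setT (T g : bX -> bX).
Proof. by apply: continuous_borel; exact: ds_continuous. Qed.

Let mS g : measurable_fun setT (S g : bY -> bY).
Proof. by apply: continuous_borel; exact: ds_continuous. Qed.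

Let rho := offdiag_marginal m phi'.

(** This is where invariance of the off-diagonal marginal is used: after
    normalization it is one of the measures against which covers of small mean
    multiplicity are tested. *)
Lemma normalized_offdiag_marginal : 0 < rho setT ->
  exists2 nu : borel_prob R X, invariant_prob T nu &
    forall A : set X, rho A = rho setT * fine (nu A).
Proof.
move=> rho0.
pose rhoM : {measure set bX -> \bar R} := offdiag_marginal_measure m phi'.
pose nu : borel_prob R X := BorelProb (mnormalize (rhoM mphi) (bp_measure mu)).
have nuE A : nu A = (rho A / rho setT)%:E.
  rewrite /= /mnormalize /=.
  by rewrite /offdiag_marginal_measure eqe gt_eqF//= eqe gt_eqF.
exists nu; last first.
  by move=> A; rewrite nuE /= mulrC divfK// gt_eqF.
move=> g A mA /=; rewrite !nuE; congr (_ / _)%:E.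
apply: (offdiag_marginal_invariant mphi (mT g) (mT g^-1%g) (mS g) (mS g^-1%g)).
- exact: dsK.
- exact: dsKV.
- exact: dsK.
- exact: dsKV.
- exact: phi_equi.
- by move=> B mB; exact: mu_inv.
- exact: mA.
Qed.

(** Suppose that the joining charges the complement of the diagonal, with total
    mass k. Fix a partition c whose squares leave out almost all of k, and
    closed sets K i filling up its pieces: distinct K i are at distance at
    least some e > 0. Take V for this e. The mean of the sum of the
    multiplicities of V over off-diagonal pairs is at most 2 b < d, so a
    definite part of the off-diagonal mass sits on pairs with sum below d.
    But such pairs with equal images under phi are at distance less than e,
    so they cannot lie in K i x K i' for distinct i and i'. *)
Lemma offdiag_marginalT_eq0 : rho setT = 0.
Proof.
apply/eqP; rewrite eq_le offdiag_marginal_ge0// andbT leNgt; apply/negP => k0.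
have [nu nu_inv nuE] := normalized_offdiag_marginal k0.
set k := rho setT in k0 nuE.
have D_gt0 : 0 < d%:R :> R by rewrite ltr0n.
(* The error budget of offdiag_gap. *)
pose eta := k * (d%:R - 2 * b) / (4 * d%:R).
have eta0 : 0 < eta.
  by rewrite divr_gt0 ?mulr_gt0// subr_gt0.
have [I [c [mc Hc]]] := offdiag_marginal_approx m mphi measurableT eta0.
pose eta' := eta / #|I|.+1%:R.
have eta'0 : 0 < eta' by rewrite divr_gt0// ltr0n.
have /choice[K HK] i := closed_inner_regular m (mc i) eta'0.
pose N : set bX := \bigcup_(i in [set: I]) (c @^-1` [set i] `\` K i).
have mK i : measurable (K i : set bX) by apply: closed_borel; case: (HK i).
have mN : measurable N.
  by apply: fin_bigcup_measurable => // i _; apply: measurableD.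
have Nc i : N `&` c @^-1` [set i] = c @^-1` [set i] `\` K i.
  apply/seteqP; split => x; last by move=> [cx Kx]; split => //; exists i.
  by move=> [[j _ [/= cj Kj]] /= ci]; split => //; rewrite -ci cj.
have fmu A : measurable (A : set bX) -> m A \is a fin_num.
  by move=> mA; exact: fin_num_measure.
have Neta : fine (m N) <= eta.
  have -> : fine (m N) = \sum_i fine (m (N `&` c @^-1` [set i])).
    apply: (additive_code (F := fine \o m) mc mN); first by rewrite /= measure0.
    by move=> A B mA mB AB; rewrite /= measureU// fineD// fmu.
  apply: (@le_trans _ _ (\sum_(i : I) eta')).
    apply: ler_sum => i _; rewrite /= Nc -lee_fin fineK; last first.
      by apply: fmu; exact: measurableD.
    by apply: ltW; case: (HK i).
  rewrite sumr_const -[_ *+ _]mulr_natr /eta' -mulrA ler_piMr ?(ltW eta0)//.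
  by rewrite mulrC ler_pdivrMr ?ltr0n// mul1r ler_nat.
have [e e0 He] : exists2 e, 0 < e & forall i i' x x', i != i' -> K i x ->
    K i' x' -> e <= mdist x x'.
  pose C : set (X * X) := \bigcup_(p in [set p : I * I | p.1 != p.2]) (K p.1 `*` K p.2).
  have cC : compact C.
    rewrite /C bigcup_fset_set; last exact: finite_finset.
    apply: bigsetU_compact => p _; apply: compact_setX.
      by apply: (subclosed_compact _ (ds_compact T_ds)) => //; case: (HK p.1).
    by apply: (subclosed_compact _ (ds_compact T_ds)) => //; case: (HK p.2).
  have [|e e0 He] := compact_positive_lb cC (@mdist_continuous R X).
    move=> [x x'] [[i i'] /= ii' [/= Kx Kx']]; rewrite mdist_gt0.
    apply/eqP => xx'; move: ii' => /eqP; apply.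
    have [_ + _] := HK i; move=> /(_ _ Kx) /= <-.
    by have [_ + _] := HK i'; move=> /(_ _ Kx') /= <-; rewrite xx'.
  by exists e => // i i' x x' ii' Kx Kx'; apply: (He (x, x')); exists (i, i').
have [J [V [oV Vb Vsep]]] := covers e0.
have mV j : measurable (V j : set bX) by exact: open_borel.
have mh := measurable_code_hits mV.
have := @offdiag_multiplicity _ _ _ _ _ m phi' mphi I J c V N d mc mV mN.
have sumV : \sum_j offdiag m phi' c (V j) <= k * b.
  apply: (@le_trans _ _ (\sum_j rho (V j))).
    by apply: ler_sum => j _; exact: (offdiag_le_marginal m mphi mc).
  under eq_bigr => j _ do rewrite nuE.
  by rewrite -mulr_sumr ler_pM2l//; exact: Vb.
have JN : offdiag m phi' c N <= eta.
  by apply: le_trans Neta; exact: offdiag_le.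
have lam0 i (A A' : {set J}) : (#|A| + #|A'| < d)%N ->
    relprod m phi' (c @^-1` [set i] `&` hits V @^-1` [set A] `\` N)
      (~` (c @^-1` [set i]) `&` hits V @^-1` [set A'] `\` N) = 0.
  move=> dA.
  (* Points of F are hit by members of V indexed by A only, and F is closed,
     unlike the atom of V given by A. *)
  pose F : set X := K i `&` \bigcap_(j in [set j | j \notin A]) ~` V j.
  have cF : closed F.
    apply: closedI; first by case: (HK i).
    by apply: closed_bigI => j _; exact: open_closedC.
  have hF x : F x -> hits V x \subset A.
    move=> [_ Fx]; apply/fintype.subsetP => j /in_hits Vj; apply: contrapT => /negP jA.
    exact: Fx Vj.
  have cphiF : closed (phi @` F).
    apply: compact_closed => //; apply: continuous_compact.
      exact: continuous_subspaceT.
    exact: (subclosed_compact cF (ds_compact T_ds)).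
  apply: (@relprod_separated _ _ _ _ _ m phi' mphi _ _ (phi @` F)).
  - by apply: measurableD => //; apply: measurableI => //; exact: mc.
  - apply: measurableD => //; apply: measurableI => //.
    by apply: measurableC; exact: mc.
  - exact: closed_borel.
  - move=> x [[/= cx hx] Nx]; exists x => //; split.
      by apply: contrapT => Kx; apply: Nx; exists i.
    by move=> j /= /negP jA /in_hits; rewrite hx.
  - apply/seteqP; split => // x' [[[/= cx' hx'] Nx'] [x Fx /= xx']].
    have Kx' : K (c x') x'.
      by apply: contrapT => Kx; apply: Nx'; exists (c x').
    have ii' : i != c x' by apply/eqP => ic; apply: cx'.
    have : mdist x x' < e.
      apply: Vsep xx'; apply: leq_ltn_trans dA; apply: leq_add.
        exact/subset_leq_card/hF.
      by rewrite /multiplicity hx'.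
    by rewrite ltNge (He i (c x'))//; case: Fx.
move=> /(_ lam0); apply/negP; rewrite -ltNge.
apply: (offdiag_gap D_gt0 _ sumV Hc JN).
by rewrite mulr_gt0// subr_gt0.
Qed.

End measure.
End injectivity_criterion.

(** * From injectivity modulo null sets to an isomorphism *)

(** Balls of radius 1 / (n + 1) around the points of a finite net, for every n. *)
Lemma borel_generator_separates (R : realType) (X : metricType R) :
  compact [set: X] -> exists B : nat -> nat -> set X,
    (forall n k, open (B n k)) /\
    forall x x', (forall n k, B n k x <-> B n k x') -> x = x'.
Proof.
move=> cX.
have inv_gt0 n : 0 < n.+1%:R^-1 :> R by [].
have /choice[s Hs] n := compact_finite_net cX (inv_gt0 n).
exists (fun n k => [set x : X |
  exists y, onth (s n) k = Some y /\ mdist y x < n.+1%:R^-1]).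
split=> [n k|x x' xx'].
  have -> : [set x | exists y, onth (s n) k = Some y /\
      mdist y x < n.+1%:R^-1] =
      \bigcup_(y in [set y | onth (s n) k = Some y])
        [set x | mdist y x < n.+1%:R^-1].
    by apply/seteqP; split => [x [y []]|x [y yk yx]]; exists y.
  by apply: bigcup_open => y _; exact: open_mdist_lt.
apply: mdist_positivity; apply/eqP; rewrite eq_le mdist_ge0 andbT.
rewrite leNgt; apply/negP => dx.
have [n nd] : exists n, n.+1%:R^-1 < mdist x x' / 2.
  exists (Num.truncn (mdist x x' / 2)^-1).
  by rewrite -ltf_pV2 ?(posrE,divr_gt0)// invrK truncnS_gt.
have [y ys yx] := Hs n x.
have /xx' [z [+ zx']] : exists z, onth (s n) (index y (s n)) = Some z
    /\ mdist z x < n.+1%:R^-1.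
  by exists y; rewrite onthE (nth_map y) ?nth_index ?index_mem.
rewrite onthE (nth_map y) ?nth_index ?index_mem// => -[yz]; rewrite -{z}yz in zx'.
have := metric_triangle x y x'; rewrite (metric_sym x y) => tri.
by move: nd yx zx' tri; move: (n.+1%:R^-1) => r; lra.
Qed.

Section injective_mod_null.
Context (R : realType) (Gamma : groupType) (X : metricType R)
  (Y : topologicalType) (T : Gamma -> X -> X) (S : Gamma -> Y -> Y)
  (phi : X -> Y).
Hypotheses (Gamma_countable : countable [set: Gamma])
  (T_ds : dynamical_system T)
  (hausY : hausdorff_space Y) (cphi : continuous phi)
  (phi_equi : forall g x, phi (T g x) = S g (phi x)).
Variable mu : borel_prob R X.
Hypothesis mu_inv : invariant_prob T mu.

Let x0 := bp_point mu.
Notation bX := (borel x0).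
Notation bY := (borel (phi x0)).
Let m : {measure set bX -> \bar R} := bp_measure mu.

Let mphi : measurable_fun setT (phi : bX -> bY).
Proof. exact: continuous_borel. Qed.

Let mpreim (A : set bX) g : measurable A -> measurable (T g @^-1` A : set bX).
Proof.
have mT : measurable_fun setT (T g : bX -> bX).
  by apply: continuous_borel; exact: ds_continuous.
by move=> mA; rewrite -[X in measurable X]setTI; exact: mT.
Qed.

Let null_bigcup (F : nat -> set bX) : (forall n, measurable (F n)) ->
  (forall n, m (F n) = 0%E) -> m (\bigcup_n F n) = 0%E.
Proof.
move=> mF F0; apply/eqP; rewrite -measure_le0.
apply: (@le_trans _ _ (\sum_(0 <= n <oo) m (F n))%E).
  by apply: measure_sigma_subadditive => //; exact: bigcup_measurable.
by rewrite eseries0.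
Qed.

(** Discard, for countably many open sets B n k separating the points of X, the
    null set on which membership in B n k is not read off from phi. *)
Lemma injective_off_null : (forall Q : set bX, measurable Q ->
    exists C : set bY, [/\ measurable C, m (Q `\` phi @^-1` C) = 0%E
      & m (phi @^-1` C `\` Q) = 0%E]) ->
  exists E : set bX, [/\ measurable E, m E = 0%E &
    forall x x', ~ E x -> ~ E x' -> phi x = phi x' -> x = x'].
Proof.
move=> H.
have [B [oB Bsep]] := borel_generator_separates (ds_compact T_ds).
have /choice[C HC] (p : nat * nat) := H (B p.1 p.2) (open_borel (oB p.1 p.2)).
pose N p : set bX := (B p.1 p.2 `\` phi @^-1` C p) `|` (phi @^-1` C p `\` B p.1 p.2).
have mB p : measurable (B p.1 p.2 : set bX) by exact: open_borel.
have mC p : measurable (phi @^-1` C p : set bX).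
  by rewrite -[X in measurable X]setTI; apply: mphi => //; case: (HC p).
have mN p : measurable (N p) by apply: measurableU; exact: measurableD.
have N0 p : m (N p) = 0%E.
  have [_ H1 H2] := HC p.
  apply/eqP; rewrite -measure_le0.
  apply: (@le_trans _ _ (m (B p.1 p.2 `\` phi @^-1` C p) +
    m (phi @^-1` C p `\` B p.1 p.2))%E).
    by apply: measureU2; exact: measurableD.
  by rewrite H1 H2 adde0.
exists (\bigcup_n \bigcup_k N (n, k)); split.
- by apply: bigcup_measurable => n _; apply: bigcup_measurable.
- by apply: null_bigcup => n; [exact: bigcup_measurable|exact: null_bigcup].
move=> x x' Ex Ex' xx'; apply: Bsep => n k.
have NB z : ~ (\bigcup_n \bigcup_k N (n, k)) z -> B n k z <-> C (n, k) (phi z).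
  move=> Ez; split=> [Bz|Cz]; apply: contrapT => nz; apply: Ez; exists n => //; exists k => //.
    by left.
  by right.
by rewrite NB// NB// xx'.
Qed.

(** Closed subsets of a compact space have compact, hence Borel, images: this
    avoids the theorem that injective images of Borel sets are Borel. *)
Lemma sigma_compact_conull (E : set bX) : measurable E -> m E = 0%E ->
  exists K : nat -> set X, [/\ forall n, closed (K n),
    forall n, K n `<=` ~` E & m (~` \bigcup_n K n) = 0%E].
Proof.
move=> mE E0; have mCE := measurableC mE.
have inv_gt0 n : 0 < n.+1%:R^-1 :> R by [].
have /choice[K HK] n := closed_inner_regular (bp_measure mu) mCE (inv_gt0 n).
exists K; split; [by move=> n; case: (HK n)..|].
have mK n : measurable (K n : set bX) by apply: closed_borel; case: (HK n).
have mUK : measurable (~` \bigcup_n K n : set bX).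
  by apply: measurableC; exact: bigcup_measurable.
apply/eqP; rewrite -measure_le0; apply/lee_addgt0Pr => e e0; rewrite add0e.
have [n ne] : exists n, n.+1%:R^-1 < e.
  exists (Num.truncn e^-1).
  by rewrite -ltf_pV2 ?(posrE,divr_gt0)// invrK truncnS_gt.
apply: (@le_trans _ _ (m (E `|` (~` E `\` K n)))).
  apply: le_measure; rewrite ?inE.
  - exact: mUK.
  - by apply: measurableU => //; exact: measurableD.
  - move=> x Kx; have [Ex|Ex] := pselect (E x); [by left|right].
    by split => // Kn; apply: Kx; exists n.
apply: (@le_trans _ _ (m E + m (~` E `\` K n))%E).
  by apply: measureU2 => //; exact: measurableD.
rewrite E0 add0e; apply: ltW; apply: (@lt_trans _ _ (n.+1%:R^-1)%:E).
  by case: (HK n).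
by rewrite lte_fin.
Qed.

(** On the sigma-compact set X2 the map phi is injective and has a Borel inverse
    psi, since phi sends closed subsets of X2 to countable unions of compact
    sets. The invariant set X3 of points whose orbit stays in X2 has a Borel
    image, namely the preimage of X3 under psi. *)
Lemma injective_induces_isomorphism (E : set bX) : measurable E -> m E = 0%E ->
  (forall x x', ~ E x -> ~ E x' -> phi x = phi x' -> x = x') ->
  induces_isomorphism T S phi mu.
Proof.
move=> mE E0 phi_inj.
have [K [cK KE K0]] := sigma_compact_conull mE E0.
pose X2 : set bX := \bigcup_n K n.
have mX2 : measurable X2 by apply: bigcup_measurable => n _; exact: closed_borel.
have X2_inj x x' : X2 x -> X2 x' -> phi x = phi x' -> x = x'.
  by move=> [n _ /KE Ex] [n' _ /KE Ex']; exact: phi_inj.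
pose X3 : set bX := \bigcap_g T g @^-1` X2.
have X3_X2 x : X3 x -> X2 x by move=> /(_ 1%g I); rewrite /= (ds1 T_ds).
have X3C : ~` X3 = \bigcup_g T g @^-1` (~` X2) by rewrite setC_bigcap.
have mX3 : measurable X3.
  rewrite -(setCK X3) X3C; apply: measurableC.
  by apply: countable_bigcupT_measurable => // g; apply: mpreim; exact: measurableC.
have X30 : m (~` X3) = 0%E.
  have [e einj'] := countable_injP _ Gamma_countable.
  have einj : injective e by move=> a b; apply: einj'; rewrite in_setT.
  (* A left inverse of an injection of Gamma into nat. *)
  pose h n := xget 1%g [set g | e g = n].
  have he g : h (e g) = g.
    by rewrite /h; case: xgetP => [g' _ /= /einj //|/(_ g) []].
  have -> : ~` X3 = \bigcup_n T (h n) @^-1` (~` X2).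
    rewrite X3C; apply/seteqP; split => x [g _ gx].
      by exists (e g) => //; rewrite he.
    by exists (h g).
  apply: null_bigcup => n; first by apply: mpreim; exact: measurableC.
  by rewrite [LHS](mu_inv (h n))//; exact: measurableC.
pose psi (y : bY) : bX := xget x0 [set x | X2 x /\ phi x = y].
have psiK x : X2 x -> psi (phi x) = x.
  move=> X2x; rewrite /psi; case: xgetP => [x' _ [X2x' /X2_inj ->//]|/(_ x)[]//].
have image_closed (F : set X) : closed F ->
    measurable (phi @` (F `&` X2) : set bY).
  move=> cF; have -> : phi @` (F `&` X2) = \bigcup_n phi @` (F `&` K n).
    apply/seteqP; split => y.
      by move=> [x [Fx [n _ Kx]] <-]; exists n => //; exists x.
    by move=> [n _ [x [Fx Kx] <-]]; exists x => //; split => //; exists n.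
  apply: bigcup_measurable => n _; apply: closed_borel.
  apply: compact_closed => //; apply: continuous_compact.
    exact: continuous_subspaceT.
  apply: (subclosed_compact _ (ds_compact T_ds)) => //; exact: closedI.
pose Y2 : set bY := phi @` X2.
have mY2 : measurable Y2.
  by rewrite /Y2 -(setTI X2); apply: image_closed; exact: closedT.
have mpsi : measurable_fun Y2 psi.
  apply: (@measurability _ _ bY bX Y2 psi open) => //.
  move=> _ [U oU <-].
  rewrite (_ : _ `&` _ = Y2 `\` phi @` (~` U `&` X2)).
    by apply: measurableD => //; apply: image_closed; exact: open_closedC.
  apply/seteqP; split => _ [[x X2x <-]] /= H; split; try by exists x.
    by move=> [x' [Ux' X2x'] /(X2_inj _ _ X2x' X2x) xx']; apply: Ux'; rewrite xx' -(psiK x).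
  by rewrite psiK//; apply: contrapT => Ux; apply: H; exists x.
pose Y3 : set bY := Y2 `&` psi @^-1` X3.
have mY3 : measurable Y3 by exact: mpsi.
have Y3P y : Y3 y -> exists2 x, X3 x & phi x = y.
  by move=> [[x X2x <-]] /=; rewrite psiK// => X3x; exists x.
have X3Y3 x : X3 x -> Y3 (phi x).
  by move=> X3x; split; [exists x => //; exact: X3_X2|rewrite /= psiK//; exact: X3_X2].
have mT1 : m setT = 1%E := probability_setT _.
have X3T g x : X3 x -> X3 (T g x).
  by move=> X3x h _ /=; rewrite -(ds_mul T_ds); exact: X3x.
have full (A : set bX) : measurable A -> m (X3 `&` A) = m A.
  move=> mA; have D0 : m (A `\` X3) = 0%E.
    apply: (subset_measure0 _ _ _ X30); [|exact: measurableC|exact: subIsetr].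
    exact: measurableD.
  have : m A = (m (A `\` X3) + m (A `&` X3))%E by exact: measureDI.
  by rewrite D0 add0e setIC.
have mpre3 : measurable (phi @^-1` Y3 : set bX).
  by rewrite -[X in measurable X]setTI; exact: mphi.
have X31 : m X3 = 1%E by rewrite -mT1 -[RHS]full// setIT.
exists psi, X3, Y3; split => //.
- by rewrite /pushforward -[LHS](full _ mpre3) setIidl//.
- by move=> g y /Y3P[x X3x <-]; rewrite -phi_equi; apply: X3Y3; exact: X3T.
- by move=> y [].
- by move=> x /X3_X2; exact: psiK.
- by move=> y /Y3P[x X3x <-]; rewrite psiK//; exact: X3_X2.
- exact: measurable_funTS.
- by apply: measurable_funS mpsi => // y [].
- move=> B mB _; rewrite /pushforward; apply: full.
  by rewrite -[X in measurable X]setTI; exact: mphi.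
Qed.

End injective_mod_null.

(** * Points in general position *)

(** Among size p distinct points of the interval from 0 to e, one is not a root. *)
Lemma nonroot_small (R : realFieldType) (p : {poly R}) (e : R) :
  p != 0 -> 0 < e -> exists t, [/\ 0 < t, t <= e & p.[t] != 0].
Proof.
move=> p0 e0; pose s := [seq e / k.+1%:R | k <- iota 0 (size p)].
have [ps|] := boolP (all (root p) s).
  have us : uniq s.
    rewrite map_inj_uniq ?iota_uniq// => k k' /(mulfI (lt0r_neq0 e0)) /invr_inj.
    by move/eqP; rewrite eqr_nat => /eqP[].
  by have := max_poly_roots p0 ps us; rewrite size_map size_iota ltnn.
rewrite -has_predC => /hasP[_ /mapP[k _ ->] /= kp]; exists (e / k.+1%:R); split => //.
  by rewrite divr_gt0// ltr0n.
by rewrite ler_pdivrMr ?ltr0n// ler_peMr ?(ltW e0)// ler1n.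
Qed.

(** Move the points towards distinct points of the moment curve by a factor t.
    Affine dependence of at most d + 1 of them makes a determinant vanish that
    is polynomial in t and, at t = 1, is a Vandermonde determinant; so all small
    t outside a finite set work. For fewer than d + 1 points the first
    coordinates alone are used, and the determinants stay square. *)
Lemma general_position (R : realFieldType) (J : finType) (d : nat)
    (u : J -> 'I_d -> R) (e : R) :
  (forall j i, 0 <= u j i <= 1) -> 0 < e ->
  exists v : J -> 'I_d -> R, [/\ forall j i, 0 <= v j i <= 1,
    forall j i, `|v j i - u j i| <= e
    & forall c : J -> R, (#|[set j | c j != 0%R]%SET| <= d.+1)%N ->
        \sum_j c j = 0 -> (forall i, \sum_j c j * v j i = 0) ->
        forall j, c j = 0].
Proof.
move=> u01 e0.
(* Distinct parameters on the moment curve, in [0, 1] to stay inside the cube. *)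
pose s (j : J) : R := (enum_rank j).+1%:R^-1.
have s_inj : injective s.
  move=> j j' /invr_inj/eqP; rewrite eqr_nat => /eqP[] /ord_inj.
  exact: enum_rank_inj.
have s01 j k : 0 <= s j ^+ k <= 1.
  by rewrite exprn_ge0 ?invr_ge0// exprn_ile1 ?invr_ge0// invf_le1// ler1n.
(* The coordinates of u j, preceded by a coordinate 1 that turns affine into
     linear independence. *)
pose U (j : J) (k : nat) : R :=
  if k is k'.+1 then (if insub k' is Some i then u j i else 0) else 1.
pose q (j : J) (k : nat) : {poly R} := (U j k)%:P * (1 - 'X) + (s j ^+ k)%:P * 'X.
pose M (A : {set J}) := \matrix_(k < #|A|, i < #|A|) q (enum_val k) i.
have detM A : \det (M A) != 0.
  apply/eqP => detM0; have : (\det (M A)).[1] = 0 by rewrite detM0 horner0.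
  rewrite -horner_evalE -det_map_mx.
  have -> : map_mx (horner_eval 1) (M A) =
      (Vandermonde #|A| (\row_(k < #|A|) s (enum_val k)))^T.
    apply/matrixP => k i; rewrite !mxE /horner_eval /q.
    by rewrite !hornerE subrr mulr0 add0r.
  rewrite det_tr det_Vandermonde => /eqP; apply/negP.
  apply/prodf_neq0 => i _; apply/prodf_neq0 => j ij.
  rewrite !mxE subr_eq0; apply/eqP => /s_inj/enum_val_inj ij'.
  by move: ij; rewrite ij' ltnn.
pose p := \prod_A \det (M A).
have p0 : p != 0 by apply/prodf_neq0 => A _; exact: detM.
have [|t [t0 te pt]] := @nonroot_small R p (Num.min e 1) p0.
  by rewrite lt_min e0 ltr01.
move: te; rewrite le_min => /andP[te t1].
exists (fun j i => (1 - t) * u j i + t * s j ^+ i.+1); split.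
- move=> j i; have /andP[u0 u1] := u01 j i; have /andP[s0 s1] := s01 j i.+1.
  by apply/andP; split; nra.
- move=> j i; have /andP[u0 u1] := u01 j i; have /andP[s0 s1] := s01 j i.+1.
  by rewrite ler_norml; apply/andP; split; nra.
move=> c cd c0 cv.
have qt j k : (q j k).[t] = (1 - t) * U j k + t * s j ^+ k.
  by rewrite /q !hornerE /=; ring.
have cU (k : nat) : (k < d.+1)%N -> \sum_j c j * (q j k).[t] = 0.
  case: k => [_|k kd].
    rewrite -[RHS]c0; apply: eq_bigr => j _; rewrite qt /= expr0; ring.
  have {}kd : (k < d)%N by [].
  rewrite -[RHS](cv (Ordinal kd)); apply: eq_bigr => j _; rewrite qt /=.
  by rewrite (insubT (fun m => m < d)%N kd).
set A := [set j | c j != 0%R]%SET in cd.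
pose r : 'rV[R]_#|A| := \row_k c (enum_val k).
have rM : r *m map_mx (horner_eval t) (M A) = 0.
  apply/rowP => i; rewrite !mxE.
  rewrite -[RHS](cU i (leq_trans (ltn_ord i) cd)).
  rewrite [RHS](bigID (mem A))/= [X in _ + X]big1 ?addr0; last first.
    by move=> j; rewrite inE negbK => /eqP ->; rewrite mul0r.
  rewrite [RHS]big_enum_val /=; apply: eq_bigr => k _.
  by rewrite !mxE.
have r0 : r = 0.
  have Mu : map_mx (horner_eval t) (M A) \in unitmx.
    have -> : map_mx (horner_eval t) (M A) \in unitmx = ((\det (M A)).[t] != 0).
      by rewrite unitmxE unitfE det_map_mx.
    by move: pt; rewrite /p horner_prod => /prodf_neq0/(_ A isT).
  by rewrite -(mulmxK Mu r) rM mul0mx.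
move=> j; apply/eqP; apply/negPn/negP => cj.
have jA : j \in A by rewrite inE.
move/rowP : r0 => /(_ (enum_rank_in jA j)); rewrite !mxE enum_rankK_in//.
by move/eqP; apply/negP.
Qed.

(** * The space of continuous functions into the cube *)

Section uniform_topology.
Context (R : realType) (X : topologicalType) (d : nat).
Local Notation C := (C_unif X (cube R d)).

Definition cube_coord (f : C) (x : X) (i : 'I_d) : R :=
  set_val ((f : continuousType X (cube R d)) x) ord0 i.

Lemma cube_coord01 f x i : 0 <= cube_coord f x i <= 1.
Proof. exact: (set_valP ((f : continuousType X (cube R d)) x)). Qed.

Lemma cube_coord_continuous f i : continuous (fun x => cube_coord f x i).
Proof.
move=> x; apply: (@continuous_comp _ _ _
  (fun x => set_val ((f : continuousType X (cube R d)) x))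
  (fun v : 'rV[R]_d => v ord0 i)); last exact: coord_continuous.
apply: (@continuous_comp _ _ _ (f : continuousType X (cube R d)) set_val).
  exact: cts_fun.
exact: initial_continuous.
Qed.

Lemma C_unif_of_coords (h : X -> 'I_d -> R) :
  (forall x i, 0 <= h x i <= 1) -> (forall i, continuous (h^~ i)) ->
  exists f : C, forall x i, cube_coord f x i = h x i.
Proof.
move=> h01 hc.
have hP x : \row_i h x i \in cube R d.
  by rewrite inE => i; rewrite mxE.
pose g (x : X) : cube R d := exist _ (\row_i h x i) (hP x).
have gc : continuous g.
  apply: continuous_comp_initial => x A [P MP sPA].
  rewrite /= in MP.
  have : \forall z \near x, forall i, P ord0 i (h z i).
    apply: filter_forall => i; apply: hc.
    by have := MP ord0 i; rewrite mxE.
  apply: filterS => z Hz; apply: sPA => i j /=.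
  by rewrite (ord1 i) mxE.
pose F : continuousType X (cube R d) := HB.pack g (isContinuous.Build _ _ g gc).
exists F => x i.
by rewrite /cube_coord /= mxE.
Qed.

(** The topology of uniform convergence in terms of coordinates: from here on the
    space of functions is only handled through the functions cube_coord f. *)
Lemma C_unif_nbhsP (f : C) (A : set C) : nbhs f A <->
  exists2 e, 0 < e & forall g : C,
    (forall x i, `|cube_coord f x i - cube_coord g x i| < e) -> A g.
Proof.
split.
  move=> [_ [[W oW <-] Wf WA]].
  have : nbhs ((f : continuousType X (cube R d)) : {uniform X -> cube R d}) W.
    exact: open_nbhs_nbhs.
  move=> /uniform_nbhs[E [entE EW]].
  move: entE; rewrite -entourage_ballE => -[e /= e0 He].
  exists e => // g fg; apply: WA; apply: EW => x _; apply: He => /=.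
  split => // i j; rewrite (ord1 i); exact: fg.
move=> [e e0 H].
have ent : entourage [set p : cube R d * cube R d | ball p.1 e p.2].
  by rewrite -entourage_ballE; exists e.
have : nbhs ((f : continuousType X (cube R d)) : {uniform X -> cube R d})
   [set h | forall y, setT y -> ball ((f : continuousType X (cube R d)) y) e (h y)].
  by apply/uniform_nbhs; exists [set p | ball p.1 e p.2]; split.
rewrite nbhsE => -[W [oW Wf] Wsub].
exists ((fun f : continuousType X (cube R d) => (f : {uniform X -> cube R d})) @^-1` W).
split => //; first by exists W.
move=> g /Wsub/= fg; apply: H => x i.
by have [_] := fg x I; exact.
Qed.

Definition uniformly_dense (G : set C) : Prop := forall f e, 0 < e ->
  exists2 g, G g & forall x i, `|cube_coord f x i - cube_coord g x i| < e.

(** With halving radii the intervals of radius e n around the values at x of the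
    coordinates of f n are nested. Their common point is the supremum of the
    left ends, and it depends continuously on x as a uniform limit. *)
Lemma nested_closed_balls (f : nat -> C) (e : nat -> R) :
  (forall n, 0 < e n) -> (forall n, e n.+1 <= e n / 2) ->
  (forall n x i, `|cube_coord (f n) x i - cube_coord (f n.+1) x i| <= e n / 2) ->
  exists g : C, forall n x i, `|cube_coord (f n) x i - cube_coord g x i| <= e n.
Proof.
move=> e0 e2 f2.
have near_fm n m x i :
    `|cube_coord (f n) x i - cube_coord (f (n + m)%N) x i| + e (n + m)%N <= e n.
  elim: m => [|m IH]; first by rewrite addn0 subrr normr0 add0r.
  rewrite addnS.
  have H1 := e2 (n + m)%N; have H2 := f2 (n + m)%N x i.
  have := ler_distD (cube_coord (f (n + m)%N) x i) (cube_coord (f n) x i)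
    (cube_coord (f (n + m).+1) x i).
  move: (`|_ - cube_coord (f (n + m)%N) x i|) (`|_ - cube_coord (f (n + m).+1) x i|) IH H1 H2.
  move=> a; move: (`|_|) => ? ? ?; lra.
have fme n m x i : `|cube_coord (f n) x i - cube_coord (f m) x i| <= e n + e m.
  have := near_fm n (m - n)%N x i; have := near_fm m (n - m)%N x i.
  have [nm|mn] := leqP n m.
    by move=> _; rewrite (subnKC nm); have := e0 m; lra.
  by rewrite (subnKC (ltnW mn)) distrC => + _; have := e0 n; lra.
have e_small r : 0 < r -> exists n, e n < r.
  move=> r0.
  (* Halving the radius at each step gives more than this. *)
  have eb n : e n <= e 0%N / n.+1%:R.
    elim: n => [|n IH]; first by rewrite divr1.
    apply: le_trans (e2 n) _.
    rewrite ler_pdivlMr ?ltr0n// -mulrA mulrC.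
    move: IH; rewrite ler_pdivlMr ?ltr0n//; apply: le_trans.
    rewrite mulrC ler_pM2l//.
    by rewrite mulrC ler_pdivrMr// -natrM ler_nat muln2 -addnn addSn addnS ltnS ltnS leq_addr.
  exists (Num.truncn (r / e 0%N)^-1).
  apply: le_lt_trans (eb _) _.
  rewrite mulrC -ltr_pdivlMr// -ltf_pV2 ?posrE ?divr_gt0// invrK.
  exact: truncnS_gt.
pose L x i : set R := [set cube_coord (f n) x i - e n | n in [set: nat]].
have Lsup x i : has_sup (L x i).
  split; first by exists (cube_coord (f 0%N) x i - e 0%N), 0%N.
  exists (cube_coord (f 0%N) x i + e 0%N) => _ [n _ <-].
  have := fme n 0%N x i; rewrite ler_norml => /andP[_ ]; lra.
pose h x i := sup (L x i).
have hf n x i : `|cube_coord (f n) x i - h x i| <= e n.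
  have H1 : cube_coord (f n) x i - e n <= h x i.
    by apply: ub_le_sup; [case: (Lsup x i)|exists n].
  have H2 : h x i <= cube_coord (f n) x i + e n.
    apply: ge_sup; first by case: (Lsup x i).
    move=> _ [m _ <-]; have := fme n m x i; rewrite ler_norml => /andP[+ _]; lra.
  by rewrite ler_norml; apply/andP; split; lra.
have [||g gh] := @C_unif_of_coords h.
- move=> x i; apply/andP; split.
    apply/ler_addgt0Pl => r /e_small[n nr]; have := hf n x i.
    have /andP[+ _] := cube_coord01 (f n) x i.
    by rewrite ler_norml => + /andP[_]; lra.
  apply/ler_addgt0Pl => r /e_small[n nr]; have := hf n x i.
  have /andP[_ +] := cube_coord01 (f n) x i.
  by rewrite ler_norml => + /andP[+ _]; lra.
- move=> i x; apply/cvgrPdist_lt => r r0.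
  have r3 : 0 < r / 3 by rewrite divr_gt0.
  have [n nr] := e_small _ r3.
  have := @cube_coord_continuous (f n) i x => /cvgrPdist_lt/(_ _ r3).
  apply: filterS => z; have := hf n x i; have := hf n z i.
  rewrite !ler_norml !ltr_norml => /andP[? ?] /andP[? ?] /andP[? ?].
  apply/andP; split; lra.
by exists g => n x i; rewrite gh.
Qed.

(** The classical proof of the Baire category theorem: each closed ball is chosen
    inside G n and inside the previous one, with at most half its radius. *)
Lemma C_unif_Baire (G : nat -> set C) : (forall n, open (G n)) ->
  (forall n, uniformly_dense (G n)) -> dense (\bigcap_n G n).
Proof.
move=> oG dG O [f0 Of0] oO.
have step n (p : C * R) : exists q : C * R, 0 < p.2 ->
    [/\ 0 < q.2, q.2 <= p.2 / 2,
        forall x i, `|cube_coord p.1 x i - cube_coord q.1 x i| <= p.2 / 2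
      & forall g, (forall x i, `|cube_coord q.1 x i - cube_coord g x i| <= q.2) -> G n g].
  have [p0|p0] := ltP 0 p.2; last by exists p; rewrite ltNge p0.
  have p2 : 0 < p.2 / 2 by rewrite divr_gt0.
  have [q Gq pq] := dG n p.1 _ p2.
  have /C_unif_nbhsP[r r0 Hr] : nbhs q (G n) by exact: open_nbhs_nbhs.
  exists (q, Num.min (p.2 / 2) (r / 2)) => _ /=; split.
  - by rewrite lt_min p2 divr_gt0.
  - by rewrite ge_min lexx.
  - by move=> x i; exact/ltW/pq.
  - move=> g Hg; apply: Hr => x i; apply: le_lt_trans (Hg x i) _.
    by rewrite gt_min; apply/orP; right; rewrite ltr_pdivrMr//; lra.
have /choice[nxt Hnxt] : forall np : nat * (C * R), exists q, 0 < np.2.2 ->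
    [/\ 0 < q.2, q.2 <= np.2.2 / 2,
        forall x i, `|cube_coord np.2.1 x i - cube_coord q.1 x i| <= np.2.2 / 2
      & forall g, (forall x i, `|cube_coord q.1 x i - cube_coord g x i| <= q.2) -> G np.1 g].
  by move=> [n p]; exact: step.
have /C_unif_nbhsP[r r0 Hr] : nbhs f0 O by exact: open_nbhs_nbhs.
pose fix s n : C * R := if n is n'.+1 then nxt (n', s n') else (f0, r / 2).
have s_gt0 n : 0 < (s n).2.
  by elim: n => [|n IH] /=; [rewrite divr_gt0|have [] := Hnxt (n, s n) IH].
have [|n|n x i|g Hg] := @nested_closed_balls (fun n => (s n).1) (fun n => (s n).2).
- exact: s_gt0.
- by have [] := Hnxt (n, s n) (s_gt0 n).
- by have [_ _ + _] := Hnxt (n, s n) (s_gt0 n); exact.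
exists g; split.
  apply: Hr => x i; apply: le_lt_trans (Hg 0%N x i) _ => /=.
  by rewrite ltr_pdivrMr//; lra.
move=> n _; have [_ _ _] := Hnxt (n, s n) (s_gt0 n); apply => x i.
exact: (Hg n.+1).
Qed.

End uniform_topology.

(** * Partitions of unity and functions that separate points *)

Section partition_of_unity.
Context (R : realType) (X : metricType R).

(** The distance to the complement of A, truncated at 1 so that it makes sense
    when A is the whole space. *)
Definition dist_out (A : set X) (x : X) : R :=
  inf ([set mdist x y | y in ~` A] `|` [set 1]).

Let dist_out_lb (A : set X) x : lbound ([set mdist x y | y in ~` A] `|` [set 1]) 0.
Proof. by move=> _ [[y _ <-]|->]; rewrite ?mdist_ge0. Qed.

Lemma dist_out_ge0 A x : 0 <= dist_out A x.
Proof. by apply: lb_le_inf; [exists 1; right|exact: dist_out_lb]. Qed.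

Lemma dist_out_eq0 A x : ~ A x -> dist_out A x = 0.
Proof.
move=> Ax; apply/eqP; rewrite eq_le dist_out_ge0 andbT.
rewrite -[leRHS](mdistxx x); apply: ge_inf; first by exists 0; exact: dist_out_lb.
by left; exists x.
Qed.

Lemma dist_out_gt0 A x : open A -> A x -> 0 < dist_out A x.
Proof.
move=> oA Ax; have /nbhs_mdist[e e0 He] : nbhs x A by exact: open_nbhs_nbhs.
apply: (@lt_le_trans _ _ (Num.min e 1)); first by rewrite lt_min e0 ltr01.
apply: lb_le_inf; first by exists 1; right.
move=> _ [[y Ay <-]|->]; rewrite ge_min ?lexx ?orbT//.
by apply/orP; left; rewrite leNgt; apply/negP => /He.
Qed.

Let dist_out_lip A x z : dist_out A x <= dist_out A z + mdist x z.
Proof.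
rewrite -lerBlDr; apply: lb_le_inf; first by exists 1; right.
have H w : ([set mdist x y | y in ~` A] `|` [set 1]) w -> dist_out A x <= w.
  by move=> Hw; apply: ge_inf => //; exists 0; exact: dist_out_lb.
move=> _ [[y Ay <-]|->]; rewrite lerBlDr.
  rewrite addrC; apply: le_trans (metric_triangle x z y).
  by apply: H; left; exists y.
by apply: le_trans (H 1 _) _; [right|rewrite lerDl mdist_ge0].
Qed.

Lemma dist_out_continuous A : continuous (dist_out A).
Proof.
move=> x; apply/cvgrPdist_lt => e e0; apply/nbhs_mdist; exists e => // z xz.
apply: le_lt_trans xz; have := dist_out_lip A x z; have := dist_out_lip A z x.
by rewrite (metric_sym z x) ler_norml => ? ?; apply/andP; split; lra.
Qed.

Lemma partition_of_unity (J : finType) (V : J -> set X) :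
  (forall j, open (V j)) -> (forall x, exists j, V j x) ->
  exists w : J -> X -> R, [/\ forall j, continuous (w j),
    forall j x, 0 <= w j x, forall x, \sum_j w j x = 1
    & forall j x, w j x != 0 -> V j x].
Proof.
move=> oV cV; pose S x := \sum_j dist_out (V j) x.
have S0 x : 0 < S x.
  have [j Vj] := cV x; rewrite /S (bigD1 j)//= ltr_pwDl//.
    exact: dist_out_gt0.
  by apply: sumr_ge0 => i _; exact: dist_out_ge0.
have cS : continuous S.
  by move=> x; apply: cvg_big => [|j _]; [exact: add_continuous|exact: dist_out_continuous].
exists (fun j x => dist_out (V j) x / S x); split.
- move=> j x; apply: cvgM; first exact: dist_out_continuous.
  by apply: cvgV; [rewrite gt_eqF|exact: cS].
- by move=> j x; rewrite divr_ge0 ?dist_out_ge0// ltW.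
- by move=> x; rewrite -mulr_suml -/(S x) divff ?gt_eqF.
- move=> j x; have [//|/dist_out_eq0 ->] := pselect (V j x).
  by rewrite mul0r eqxx.
Qed.

End partition_of_unity.

Section lower_semicontinuity.
Context (X : topologicalType) (J : finType) (V : J -> set X).
Hypothesis oV : forall j, open (V j).

(** Lower semicontinuity: points near x lie in every V j that contains x. *)
Lemma multiplicity_nbhs x :
  \forall z \near x, (multiplicity V x <= multiplicity V z)%N.
Proof.
have : \forall z \near x, forall j, V j x -> V j z.
  apply: filter_forall => j; have [Vx|Vx] := pselect (V j x); last exact: nearW.
  have : nbhs x (V j) by exact: open_nbhs_nbhs.
  by apply: filterS.
apply: filterS => z H; apply: subset_leq_card; apply/fintype.subsetP => j.
by move=> /in_hits/H/in_hits.
Qed.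

Lemma closed_multiplicity_lt (D : nat) :
  closed [set p : X * X | (multiplicity V p.1 + multiplicity V p.2 < D)%N].
Proof.
rewrite -[X in closed X]setCK; apply: open_closedC; rewrite openE => -[x y] /= /negP.
rewrite -leqNgt => Dxy.
exists ([set z | (multiplicity V x <= multiplicity V z)%N],
        [set z | (multiplicity V y <= multiplicity V z)%N]).
  by split; exact: multiplicity_nbhs.
move=> [z t] [/= xz yt]; apply/negP; rewrite -leqNgt.
by apply: leq_trans Dxy _; exact: leq_add.
Qed.

End lower_semicontinuity.

Section separating_functions.
Context (R : realType) (Gamma : groupType) (X : metricType R)
  (T : Gamma -> X -> X) (d : nat) (b : R) (D : nat).
Hypothesis cX : compact [set: X].
Local Notation C := (C_unif X (cube R d)).

(** The functions for which points in low-multiplicity position relative to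
    some cover V are told apart up to e. The threshold D will be d + 2, which
    in terms of orders means ord(V,x) + ord(V,x') < d. *)
Definition separating (e : R) : set C := [set f |
  exists (J : finType) (V : J -> set X),
    [/\ forall j, open (V j), invariant_multiplicity_le T b V
      & forall x x', (multiplicity V x + multiplicity V x' < D)%N ->
          (forall i, cube_coord f x i = cube_coord f x' i) -> mdist x x' < e]].

(** The same cover V serves for all functions near f: the pairs to be separated
    form a compact set, on which f x and f x' stay at a positive distance. *)
Lemma open_separating e : open (separating e).
Proof.
rewrite openE => f [J [V [oV bV sepV]]]; apply/C_unif_nbhsP.
pose K := [set p : X * X | (multiplicity V p.1 + multiplicity V p.2 < D)%N]
   `&` [set p | e <= mdist p.1 p.2].
have cK : compact K.
  apply: (subclosed_compact _ (compact_setX cX cX)); last by [].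
  apply: closedI; first exact: closed_multiplicity_lt.
  apply: (@preimage_closed _ _ (fun p : X * X => mdist p.1 p.2) [set r | e <= r]).
    by move=> ? _; exact: mdist_continuous.
  exact: closed_ge.
pose g (p : X * X) := \sum_i `|cube_coord f p.1 i - cube_coord f p.2 i|.
have cg : continuous g.
  move=> p; apply: cvg_big => [|i _]; first exact: add_continuous.
  apply: cvg_norm; apply: cvgB.
    apply: (@continuous_comp _ _ _ fst (fun x => cube_coord f x i)); first exact: cvg_fst.
    exact: cube_coord_continuous.
  apply: (@continuous_comp _ _ _ snd (fun x => cube_coord f x i)); first exact: cvg_snd.
  exact: cube_coord_continuous.
have g0 p : K p -> 0 < g p.
  move=> [/= Mp ep]; rewrite lt_neqAle sumr_ge0// andbT eq_sym.
  apply/negP => /eqP gp; move: ep; apply/negP; rewrite -ltNge; apply: sepV => // i.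
  apply/eqP; rewrite -subr_eq0 -normr_eq0; apply/eqP.
  by apply: (psumr_eq0P _ gp).
have [r r0 Hr] := compact_positive_lb cK cg g0.
have d2 : 0 < (2 * d.+1)%:R :> R by rewrite ltr0n.
exists (r / (2 * d.+1)%:R); first by rewrite divr_gt0.
move=> h fh; exists J, V; split => // x x' Mxx' hxx'.
rewrite ltNge; apply/negP => exx'.
have := Hr (x, x') (conj Mxx' exx'); rewrite leNgt => /negP; apply.
apply: (@le_lt_trans _ _ (\sum_(i < d) (2 * (r / (2 * d.+1)%:R)))).
  apply: ler_sum => i _ /=; have := fh x i; have := fh x' i; rewrite hxx'.
  have := ler_distD (cube_coord h x' i) (cube_coord f x i) (cube_coord f x' i).
  rewrite (distrC (cube_coord h x' i)).
  move: (r / _) => q; lra.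
rewrite sumr_const card_ord -[_ *+ _]mulr_natr natrM invfM.
rewrite (mulrCA 2) (mulrA 2) divff ?pnatr_eq0// mul1r -mulrA gtr_pMr//.
by rewrite mulrC ltr_pdivrMr ?ltr0n// mul1r ltr_nat.
Qed.

End separating_functions.

(** * Dimension and density of separating functions *)

Section dimension.
Context (R : realType) (Gamma : groupType) (X : topologicalType)
  (T : Gamma -> X -> X).

Lemma integral_sum_indic (x0 : X) (nu : probability (borel x0) R)
    (s : seq (set X)) : (forall A, A \in s -> open A) ->
  nu.-integrable setT (fun x => \sum_(A <- s) (\1_A x)%:E)%E /\
  (\int[nu]_x (\sum_(A <- s) (\1_A x)%:E) = (\sum_(A <- s) fine (nu A))%:E)%E.
Proof.
elim: s => [_|A s IH os].
  under eq_fun do rewrite big_nil.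
  by rewrite integral0 big_nil; split => //; exact: integrable0.
have [|ints intE] := IH; first by move=> B Bs; apply: os; rewrite inE Bs orbT.
have mA : measurable (A : set (borel x0)).
  by apply: open_borel; apply: os; rewrite mem_head.
have intA := integrable_indic nu mA.
under eq_fun do rewrite big_cons.
split; first exact: integrableD.
rewrite integralD// intE integral_indic// setIT big_cons EFinD fineK//.
exact: fin_num_measure.
Qed.

Lemma integral_cov_ord (nu : borel_prob R X) (s : seq (set X)) : uniq s ->
  (forall A, A \in s -> open A) ->
  (\int[bp_measure nu]_x (cov_ord R [set` s] x)%:E)%E =
  (-1 + \sum_(A <- s) fine (nu A))%:E.
Proof.
move=> us os.
have -> : (fun x : X => (cov_ord R [set` s] x)%:E) =
    (fun x => (-1)%:E + \sum_(A <- s) (\1_A x : R)%:E)%E.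
  by apply/funext => x; rewrite /cov_ord -fsbig_seq// EFinD sumEFin.
have [ints intE] := integral_sum_indic (bp_measure nu) os.
rewrite integralD//; last exact: finite_measure_integrable_cst.
rewrite intE integral_cst//. 
by rewrite [X in (_ * X + _)%E](_ : _ = 1%E) ?mule1//; exact: probability_setT.
Qed.

(** The bound is b + 1 because multiplicities exceed orders by 1. *)
Lemma cover_of_ds_dim_lt (b : R) (U : set (set X)) : (ds_dim R T < b%:E)%E ->
  Cov U -> exists (J : finType) (V : J -> set X),
    [/\ forall j, open (V j), forall x, exists j, V j x,
        forall j, exists2 B, U B & V j `<=` B
      & invariant_multiplicity_le T (b + 1) V].
Proof.
move=> dim_lt CU.
have : (ereal_inf [set ereal_sup
      [set (\int[bp_measure mu]_x (cov_ord R V x)%:E)%E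
        | mu in invariant_prob (R := R) T]
    | V in [set V | Cov V /\ refines V U]] < b%:E)%E.
  by apply: le_lt_trans dim_lt; apply: ereal_sup_ubound; exists U.
move=> /ereal_inf_lt[_ [V [[finV oV cV] VU] <-] supV].
have [s0 sV] := (finite_seqP V).1 finV.
pose s := undup s0.
have {}sV : V = [set` s] by rewrite sV; apply/seteqP; split => A /=; rewrite mem_undup.
have us : uniq s by exact: undup_uniq.
pose W (j : 'I_(size s)) : set X := nth set0 s j.
have WV j : V (W j) by rewrite sV /= mem_nth.
exists 'I_(size s), W; split.
- by move=> j; exact: oV.
- move=> x; have : (\bigcup_(A in V) A) x by rewrite cV.
  move=> [A]; rewrite sV /= => As Ax.
  have As' : (index A s < size s)%N by rewrite index_mem.
  by exists (Ordinal As'); rewrite /W /= nth_index.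
- by move=> j; exact: VU.
- move=> nu nu_inv.
  have : ((-1 + \sum_(A <- s) fine (nu A))%:E < b%:E)%E.
    apply: le_lt_trans supV; apply: ereal_sup_ubound; exists nu => //.
    rewrite sV integral_cov_ord// => A As; apply: oV; rewrite sV; exact: As.
  rewrite lte_fin (big_nth set0) big_mkord => /ltW.
  rewrite /W; lra.
Qed.

End dimension.

Section density.
Context (R : realType) (Gamma : groupType) (X : metricType R)
  (T : Gamma -> X -> X) (d : nat) (b : R).
Hypothesis cX : compact [set: X].
Hypothesis covers : forall U : set (set X), Cov U ->
  exists (J : finType) (V : J -> set X),
    [/\ forall j, open (V j), forall x, exists j, V j x,
        forall j, exists2 B, U B & V j `<=` B
      & invariant_multiplicity_le T b V].

(** Approximate f by x |-> sum of w j x * v j over j, for a partition of unity w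
    subordinate to a fine cover V of small mean multiplicity and points v j in
    general position near the values of f on V j. When the approximation takes
    the same value at x and x' and at most d + 1 sets of V contain x or x',
    affine independence forces w j x = w j x' for all j, so that x and x' lie
    in a common V j. *)
Lemma uniformly_dense_separating e : 0 < e ->
  uniformly_dense (separating (d := d) T b d.+2 e).
Proof.
move=> e0 f r r0.
have r4 : 0 < r / 4 by rewrite divr_gt0.
have e2 : 0 < e / 2 by rewrite divr_gt0.
(* Small in X and with small image under f. *)
pose W0 y := [set x : X | mdist y x < e / 2] `&`
  [set x | forall i, `|cube_coord f y i - cube_coord f x i| < r / 4].
pose W y := (W0 y)°.
have Wy y : W y y.
  apply: filterI; first by apply/nbhs_mdist; exists (e / 2).
  apply: filter_forall => i.
  by have := @cube_coord_continuous _ _ _ f i y => /cvgrPdist_lt/(_ _ r4).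
have W_sub y x : W y x -> W0 y x by exact: interior_subset.
have [s Hs] := compact_finite_subcover cX (fun y => @open_interior _ (W0 y)) Wy.
have [|J [V [oV cV VU bV]]] := covers (U := [set W y | y in [set` s]]).
  split.
  - by apply: finite_image; exact: finite_seq.
  - by move=> _ [y _ <-]; exact: open_interior.
  - apply/seteqP; split => // x _; have [y ys Wyx] := Hs x.
    by exists (W y) => //; exists y.
have /choice[y Hy] j : exists y, V j `<=` W0 y.
  have [_ [y _ <-] VW] := VU j; exists y => x /VW; exact: W_sub.
have u01 j i : 0 <= cube_coord f (y j) i <= 1 := cube_coord01 f (y j) i.
have [v [v01 vu gp]] := general_position u01 r4.
have [w [cw w0 w1 wV]] := partition_of_unity oV cV.
pose h x i := \sum_j w j x * v j i.
have [||g gh] := @C_unif_of_coords R X d h.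
- move=> x i; apply/andP; split.
    by apply: sumr_ge0 => j _; rewrite mulr_ge0//; have /andP[] := v01 j i.
  rewrite -(w1 x); apply: ler_sum => j _; rewrite ler_piMr//.
  by have /andP[] := v01 j i.
- move=> i x; apply: cvg_big => [|j _]; first exact: add_continuous.
  by apply: cvgMl; exact: cw.
exists g; last first.
  move=> x i; rewrite gh.
  apply: (@le_lt_trans _ _ (r / 2)); last by rewrite ltr_pdivrMr//; lra.
  have -> : cube_coord f x i - h x i = \sum_j w j x * (cube_coord f x i - v j i).
    rewrite -[X in X - _]mul1r -(w1 x) mulr_suml -sumrB.
    by apply: eq_bigr => j _; rewrite mulrBr.
  apply: le_trans (ler_norm_sum _ _ _) _.
  rewrite -[leRHS]mul1r -[X in _ <= X * _](w1 x) mulr_suml; apply: ler_sum => j _.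
  rewrite normrM ger0_norm//.
  have [->|wj] := eqVneq (w j x) 0; first by rewrite !mul0r.
  rewrite ler_wpM2l//.
  have [_ /(_ i)] := Hy j x (wV _ _ wj); have := vu j i.
  rewrite !(ler_norml,ltr_norml) => /andP[? ?] /andP[? ?]; apply/andP; split; lra.
exists J, V; split => // x x' Mxx' gxx'.
have wxx' j : w j x - w j x' = 0.
  apply: (gp (fun j => w j x - w j x')).
  - apply: leq_trans (_ : #|hits V x :|: hits V x'| <= _)%N; last first.
      by apply: leq_trans (leq_card_setU _ _) _.
    apply: subset_leq_card; apply/fintype.subsetP => k; rewrite inE => wk.
    apply/setUP; have [wkx|wkx] := eqVneq (w k x) 0.
      right; apply/in_hits/wV; apply: contraNneq wk => ->.
      by rewrite wkx subrr.
    by left; apply/in_hits/wV.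
  - by rewrite sumrB !w1 subrr.
  - move=> i; under eq_bigr do rewrite mulrBl.
    by rewrite sumrB -/(h x i) -/(h x' i) -!gh gxx' subrr.
have [j wj] : exists j, w j x != 0.
  apply: contrapT => H; have := w1 x; rewrite big1 => [/eqP|j _].
    by rewrite eq_sym oner_eq0.
  by apply/eqP/negPn/negP => wj; apply: H; exists j.
have wj' : w j x' != 0.
  by have /eqP := wxx' j; rewrite subr_eq0 => /eqP <-.
have [/= yx _] := Hy j x (wV _ _ wj); have [/= yx' _] := Hy j x' (wV _ _ wj').
have := metric_triangle x (y j) x'; rewrite (metric_sym x (y j)).
move: yx yx'; lra.
Qed.

End density.

(** * Orbit maps into the shift space *)

Section orbit_maps.
Context (R : realType) (Gamma : groupType) (X : topologicalType)
  (T : Gamma -> X -> X) (d : nat).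
Hypothesis T_ds : dynamical_system T.
Implicit Type f : C_unif X (cube R d).

Lemma orbit_map_continuous f : continuous (orbit_map T f).
Proof.
move=> x; have FF : Filter (orbit_map T f @ nbhs x) by exact: fmap_filter.
apply/cvg_sup => h.
apply: (@continuous_comp_initial _ _ _ (proj h) (orbit_map T f)).
move=> z; apply: (@continuous_comp _ _ _ (T h^-1%g)
  (f : continuousType X (cube R d))).
  exact: ds_continuous.
exact: cts_fun.
Qed.

Lemma orbit_map_equivariant f g x :
  orbit_map T f (T g x) = shift_action g (orbit_map T f x).
Proof.
apply/funext => h; rewrite /orbit_map /shift_action.
by rewrite -(ds_mul T_ds) invgM invgK.
Qed.

Lemma orbit_map_eq f x x' : orbit_map T f x = orbit_map T f x' ->
  forall i, cube_coord f x i = cube_coord f x' i.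
Proof.
move=> /(congr1 (fun y : shift_space R Gamma d => y 1%g)).
by rewrite /orbit_map invg1 !(ds1 T_ds) /cube_coord => -> i.
Qed.

End orbit_maps.

Lemma hausdorff_separating (I : Type) (X Y : topologicalType) (w : I -> X -> Y) :
  hausdorff_space Y -> (forall i, continuous (w i)) ->
  (forall x x', (forall i, w i x = w i x') -> x = x') -> hausdorff_space X.
Proof.
move=> hY cw winj x x' xx'; apply: winj => i; apply: hY => A B wA wB.
by have [z [Az Bz]] := xx' _ _ (cw i x _ wA) (cw i x' _ wB); exists (w i z).
Qed.

Lemma hausdorff_cube (R : realType) (d : nat) : hausdorff_space (cube R d).
Proof.
apply: (@hausdorff_separating 'I_d _ R (fun i (v : cube R d) => set_val v ord0 i)).
- exact: Rhausdorff.
- move=> i v; apply: (@continuous_comp _ _ _ set_val (fun v : 'rV[R]_d => v ord0 i)).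
    exact: initial_continuous.
  exact: coord_continuous.
- by move=> v v' vv'; apply: val_inj; apply/rowP => i; exact: vv'.
Qed.

Lemma hausdorff_shift_space (R : realType) (Gamma : groupType) (d : nat) :
  hausdorff_space (shift_space R Gamma d).
Proof. by apply: hausdorff_product => _; exact: hausdorff_cube. Qed.

Theorem theorem10p1 (R : realType) (Gamma : groupType)
    (Gamma_countable : countable [set: Gamma])
    (X : metricType R) (T : Gamma -> X -> X)
    (T_ds : dynamical_system T)
    (d : nat) (d_gt0 : (0 < d)%N)
    (dim_lt : (ds_dim R T < (d%:R / 2)%:E)%E) :
  exists G : set (C_unif X (cube R d)),
    [/\ dense G, Gdelta G
      & forall f, G f ->
          almost_embedding R T (@shift_action R Gamma d) (orbit_map T f)].
Proof.
have cX := ds_compact T_ds.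
have [beta dim_beta beta_lt] :
    exists2 beta, (ds_dim R T < beta%:E)%E & beta < d%:R / 2.
  case: (ds_dim R T) dim_lt => [r|//|_].
    by rewrite lte_fin => rd; exists ((r + d%:R / 2) / 2); rewrite ?lte_fin; lra.
  by exists (d%:R / 2 - 1); [exact: ltNyr|rewrite ltrBlDr ltrDl].
pose G n := separating (d := d) T (beta + 1) d.+2 n.+1%:R^-1.
exists (\bigcap_n G n); split.
- apply: C_unif_Baire => n; first exact: open_separating.
  apply: uniformly_dense_separating => // U CU.
  exact: cover_of_ds_dim_lt.
- by exists G => // n; exact: open_separating.
move=> f Gf; split.
- exact: orbit_map_continuous.
- exact: orbit_map_equivariant.
move=> mu mu_inv.
have S_ds := shift_action_ds R Gamma d.
have hY := @hausdorff_shift_space R Gamma d.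
have cphi : continuous (orbit_map T f) by exact: orbit_map_continuous.
have ephi := orbit_map_equivariant T_ds f.
have b_lt : 2 * (beta + 1) < d.+2%:R.
  by rewrite -addn2 natrD; lra.
have covers e : 0 < e -> exists (J : finType) (V : J -> set X),
  [/\ forall j, open (V j), invariant_multiplicity_le T (beta + 1) V
    & forall x x', (multiplicity V x + multiplicity V x' < d.+2)%N ->
        orbit_map T f x = orbit_map T f x' -> mdist x x' < e].
  move=> e0; have [n ne] : exists n, n.+1%:R^-1 < e.
    exists (Num.truncn e^-1).
    by rewrite -ltf_pV2 ?(posrE,divr_gt0)// invrK truncnS_gt.
  have [J [V [oV bV sepV]]] := Gf n I; exists J, V; split => // x x' Mxx' /(orbit_map_eq T_ds).
  by move=> /(sepV _ _ Mxx') /lt_trans; apply.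
have rho0 := offdiag_marginalT_eq0 T_ds S_ds hY cphi ephi (ltn0Sn _) b_lt covers mu_inv.
have [|E [mE E0 Einj]] := injective_off_null T_ds cphi (mu := mu).
  move=> Q mQ; apply: relprod_compl_eq0 => //.
    exact: continuous_borel.
  apply: offdiag_marginal_eq0 => //; exact: continuous_borel.
exact: (injective_induces_isomorphism Gamma_countable T_ds hY cphi ephi mu_inv mE E0).
Qed.
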